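(* Let $P$ be a commutative noetherian ring, $\mathfrak{n}$ a maximal ideal of $P$, and $k=P/\mathfrak{n}$. Let $I\subseteq \mathfrak{n}$ be an ideal of $P$ that contains a $P$-regular element, set $R:=P/I$, and let $M$ be an $R$-complex (a complex of $R$-modules). Then: (1) For each $f\in I$ there exists an $h\in \mathfrak{n} I$ such that $f+h$ is $P$-regular. (2) Let $f$ and $g$ be $P$-regular elements lying in $I$. If $f-g\in \mathfrak{n} I$, then there is an isomorphism of graded $k$-vector spaces $$\operatorname{Tor}^{P/(f)}(k,M)\cong \operatorname{Tor}^{P/(g)}(k,M).$$ (3) If $f$ is a $P$-regular element lying in $\mathfrak{n} I$, then there is an isomorphism of graded $k$-vector spaces $$\operatorname{Tor}^{P/(f)}(k,M)\cong \operatorname{Tor}^{P}(k,M)\otimes_k k\langle y\rangle ,\quad\text{with } |y|=2.$$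
   Context: An element of $P$ is $P$-regular if it is not a zero divisor on $P$. For $f\in I$, $M$ is viewed as a complex over $P/(f)$ (and over $P$) by restriction of scalars along the canonical surjections $P\to P/(f)\to R$. For a ring $Q$ and $Q$-complexes $L,M$, $\operatorname{Tor}^{Q}(L,M)=\bigoplus_{i}\operatorname{Tor}_i^{Q}(L,M)$ is the graded module given by the homology of the derived tensor product $L\otimes^{\mathbf L}_Q M$. $k\langle y\rangle$ is the divided power algebra on a variable $y$ of degree $2$; as a graded $k$-vector space it has basis $\{y^{(i)}\}_{i\geq 0}$ with $y^{(i)}$ in degree $2i$. *)

(* Defs.v *)
From HB Require Import structures.
From mathcomp Require Import all_boot all_order all_algebra.
From mathcomp Require Import boolp classical_sets fsbigop.

Set Implicit Arguments.
Unset Strict Implicit.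
Unset Printing Implicit Defensive.

Import GRing.Theory.

Local Open Scope ring_scope.
Local Open Scope quotient_scope.

Definition is_ideal (P : comNzRingType) (J : set P) : Prop :=
  J 0 /\ forall a x y, J x -> J y -> J (a * x + y).

Definition noetherian (P : comNzRingType) : Prop :=
  forall J : set P, is_ideal J ->
  exists s : seq P,
    forall x, J x <-> exists c : P -> P, x = \sum_(a <- s) c a * a.

(* The elements of [idealr P] are the proper ideals of [P]. *)
Definition maximal_ideal (P : comNzRingType) (n : idealr P) : Prop :=
  forall J : idealr P, {subset n <= J} -> {subset J <= n}.

Definition ideal_prod (P : comNzRingType) (I J : idealr P) (x : P) : Prop :=
  exists2 s : seq (P * P),
    {in s, forall p, p.1 \in I /\ p.2 \in J} & x = \sum_(p <- s) p.1 * p.2.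

(* The ideal (f) is proper because f lies in the proper ideal I. *)
Definition principal (P : comNzRingType) (I : idealr P) (f : P)
    (If : f \in I) : {pred P} :=
  fun x => `[< exists a, x = a * f >].

Section Principal.
Variables (P : comNzRingType) (I : idealr P) (f : P) (If : f \in I).

Lemma principal_sub : {subset principal If <= I}.
Proof. by move=> x /asboolP[a ->]; apply: idealMr. Qed.

Fact principal_closed : idealr_closed (principal If).
Proof.
split.
- by apply/asboolP; exists 0; rewrite mul0r.
- by apply/negP => /principal_sub; rewrite idealr1.
- move=> a _ _ /asboolP[u ->] /asboolP[v ->]; apply/asboolP.
  by exists (a * u + v); rewrite mulrDl mulrA.
Qed.
HB.instance Definition _ := isIdealr.Build P (principal If) principal_closed.
End Principal.
Arguments principal_sub {P I f} If _ _.

Section QuotientMap.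
Variables (P : comNzRingType) (J I : idealr P) (sJI : {subset J <= I}).

Definition quot_map (_ : {subset J <= I}) (x : {ideal_quot J}) :
  {ideal_quot I} := \pi_{ideal_quot I} (repr x).

Lemma quot_mapE x : quot_map sJI (\pi_{ideal_quot J} x) = \pi_{ideal_quot I} x.
Proof.
apply/eqP; rewrite piE Quotient.equivE; apply: sJI.
by rewrite Quotient.idealrBE reprK.
Qed.

Fact quot_map_zmod_morphism : zmod_morphism (quot_map sJI).
Proof.
move=> x y; rewrite -[x]reprK -[y]reprK -rmorphB !quot_mapE.
exact: rmorphB.
Qed.

Fact quot_map_monoid_morphism : monoid_morphism (quot_map sJI).
Proof.
split; first by rewrite -(rmorph1 (\pi_{ideal_quot J})) quot_mapE rmorph1.
move=> x y; rewrite -[x]reprK -[y]reprK -rmorphM !quot_mapE.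
exact: rmorphM.
Qed.

HB.instance Definition _ := GRing.isZmodMorphism.Build
  {ideal_quot J} {ideal_quot I} (quot_map sJI) quot_map_zmod_morphism.
HB.instance Definition _ := GRing.isMonoidMorphism.Build
  {ideal_quot J} {ideal_quot I} (quot_map sJI) quot_map_monoid_morphism.

Lemma quot_map_surj y : exists x, quot_map sJI x = y.
Proof. by exists (\pi_{ideal_quot J} (repr y)); rewrite quot_mapE reprK. Qed.
End QuotientMap.

Definition quot_proj (P : comNzRingType) (I : idealr P) :
  {rmorphism P -> {ideal_quot I}} := \pi_{ideal_quot I}.

Lemma quot_proj_surj (P : comNzRingType) (I : idealr P) (y : {ideal_quot I}) :
  exists x, quot_proj I x = y.
Proof. by exists (repr y); rewrite /quot_proj /= reprK. Qed.

Definition bilin (Q : comNzRingType) (U V W : lmodType Q) (b : U -> V -> W) :=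
  (forall y, linear (b^~ y)) /\ (forall x, linear (b x)).

Section Tensor.
Variables (Q : comNzRingType) (U V : lmodType Q).

Definition tsum (W : lmodType Q) (b : U -> V -> W) (s : seq (U * V)) : W :=
  \sum_(p <- s) b p.1 p.2.

(* A sequence of pairs (x, y) stands for the formal sum of the x (x) y. Two
   formal sums are identified when every bilinear map takes the same value on
   them; by the universal property, this is equality in U (x) V. *)
Definition tensor_eq (s t : seq (U * V)) : bool :=
  `[< forall (W : lmodType Q) (b : U -> V -> W), bilin b ->
        tsum b s = tsum b t >].

Fact tensor_eq_equiv : equiv_class_of tensor_eq.
Proof.
split=> [s|s t|t s u]; first exact/asboolP.
- by apply/asboolP/asboolP => st W b bb; rewrite st.
- move=> /asboolP st /asboolP tu; apply/asboolP => W b bb.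
  by rewrite st // tu.
Qed.
Canonical tensor_equiv := EquivRelPack tensor_eq_equiv.
Canonical tensor_encModRel := defaultEncModRel tensor_eq.

Definition tensor := {eq_quot tensor_eq}.
HB.instance Definition _ : EqQuotient _ tensor_eq tensor :=
  EqQuotient.on tensor.
HB.instance Definition _ := Choice.on tensor.

Local Notation cls s := (\pi_tensor s).

Fact tensorP s t : (forall (W : lmodType Q) (b : U -> V -> W), bilin b ->
  tsum b s = tsum b t) -> cls s = cls t.
Proof. by move=> st; apply/eqP; rewrite piE; apply/asboolP. Qed.

Fact tsum_repr (W : lmodType Q) (b : U -> V -> W) s : bilin b ->
  tsum b (repr (cls s)) = tsum b s.
Proof.
move=> bb; have /eqP : cls (repr (cls s)) = cls s by rewrite reprK.
by rewrite piE => /asboolP; apply.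
Qed.

Fact tsum_cat (W : lmodType Q) (b : U -> V -> W) s t :
  tsum b (s ++ t) = tsum b s + tsum b t.
Proof. by rewrite /tsum big_cat. Qed.

Definition tscale_seq a (s : seq (U * V)) := [seq (a *: p.1, p.2) | p <- s].

Fact tsum_scale (W : lmodType Q) (b : U -> V -> W) a s : bilin b ->
  tsum b (tscale_seq a s) = a *: tsum b s.
Proof.
move=> [bl _]; rewrite /tsum big_map scaler_sumr; apply: eq_bigr => p _ /=.
pose f := GRing.isLinear.Build Q U W _ (b^~ p.2) (bl p.2).
pose g : {linear U -> W} := HB.pack (b^~ p.2) f.
exact: (linearZ_LR g).
Qed.

Definition tzero : tensor := cls [::].
Definition tadd (x y : tensor) : tensor := cls (repr x ++ repr y).
Definition tscale a (x : tensor) : tensor := cls (tscale_seq a (repr x)).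
Definition topp (x : tensor) : tensor := tscale (-1) x.

Let tsE := (tsum_repr, tsum_cat, tsum_scale).

Fact taddA : associative tadd.
Proof.
by move=> x y z; apply: tensorP => W b bb; rewrite !tsE // addrA.
Qed.
Fact taddC : commutative tadd.
Proof. by move=> x y; apply: tensorP => W b bb; rewrite !tsE // addrC. Qed.
Fact tadd0 : left_id tzero tadd.
Proof.
move=> x; rewrite -[RHS]reprK; apply: tensorP => W b bb.
by rewrite !tsE // /tsum big_nil add0r.
Qed.
Fact taddN : left_inverse tzero topp tadd.
Proof.
move=> x; apply: tensorP => W b bb.
by rewrite !tsE // scaleN1r addNr /tsum big_nil.
Qed.
HB.instance Definition _ :=
  GRing.isZmodule.Build tensor taddA taddC tadd0 taddN.

Fact tscaleA a c x : tscale a (tscale c x) = tscale (a * c) x.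
Proof. by apply: tensorP => W b bb; rewrite !tsE // scalerA. Qed.
Fact tscale1 : left_id 1 tscale.
Proof.
move=> x; rewrite -[RHS]reprK; apply: tensorP => W b bb.
by rewrite !tsE // scale1r.
Qed.
Fact tscaleDr : right_distributive tscale +%R.
Proof. by move=> a x y; apply: tensorP => W b bb; rewrite !tsE // scalerDr. Qed.
Fact tscaleDl x : {morph tscale^~ x : a c / a + c}.
Proof. by move=> a c; apply: tensorP => W b bb; rewrite !tsE // scalerDl. Qed.
HB.instance Definition _ := GRing.Zmodule_isLmodule.Build Q tensor
  tscaleA tscale1 tscaleDr tscaleDl.

Definition tens (x : U) (y : V) : tensor := cls [:: (x, y)].

Section Lift.
Variables (W : lmodType Q) (b : U -> V -> W) (bb : bilin b).

Definition tlift (_ : bilin b) (t : tensor) : W := tsum b (repr t).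

Fact tlift_linear : linear (tlift bb).
Proof.
by move=> a s t; rewrite /tlift [LHS]tsum_repr // tsum_cat tsum_repr //
  tsum_scale.
Qed.
HB.instance Definition _ :=
  GRing.isLinear.Build Q tensor W _ (tlift bb) tlift_linear.

Lemma tliftE x y : tlift bb (tens x y) = b x y.
Proof. by rewrite /tlift tsum_repr // /tsum big_seq1. Qed.
End Lift.

Lemma tens_bilin : bilin tens.
Proof.
split=> [y a x x'|x a y y']; apply: tensorP => W b bb.
- rewrite !tsE // /tsum !big_seq1; exact: bb.1.
- rewrite !tsE // /tsum !big_seq1; exact: bb.2.
Qed.

Lemma tens_sum (t : tensor) : exists s : seq (U * V),
  t = \sum_(p <- s) tens p.1 p.2.
Proof.
exists (repr t); rewrite -[LHS]reprK.
elim: (repr t) => [|p s IHs]; first by rewrite big_nil.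
rewrite big_cons -IHs; apply: tensorP => W b bb.
by rewrite !tsE // -tsum_cat /= -surjective_pairing.
Qed.
End Tensor.

(* A Z-graded module is given by its total module, the direct sum of the
   homogeneous components, together with the projections [gpr i] onto them:
   the component of degree i is the submodule of all x with gpr i x = x. *)
Record gmod (Q : comNzRingType) := GMod {
  gsort :> lmodType Q;
  gpr : int -> {linear gsort -> gsort};
  gprK : forall i j x, gpr i (gpr j x) = if i == j then gpr j x else 0;
  gpr_gen : forall x, exists2 s : seq (int * gsort),
    {in s, forall p, gpr p.1 p.2 = p.2} & x = \sum_(p <- s) p.2
}.

Arguments gpr {Q _} i.

Definition giso (Q : comNzRingType) (A B : gmod Q) : Prop :=
  exists f : {linear A -> B},
    bijective f /\ forall i x, f (gpr i x) = gpr i (f x).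

Record complex (Q : comNzRingType) := Complex {
  cgr :> gmod Q;
  cd : {linear cgr -> cgr};
  cdd : forall x, cd (cd x) = 0;
  cd_deg : forall i x, cd (gpr i x) = gpr (i - 1) (cd x)
}.

Arguments cd {Q _}.

Section GradedTheory.
Variables (Q : comNzRingType) (A : gmod Q).
Implicit Types x y : A.

Lemma gpr_homog i j x : gpr j x = x -> gpr i x = if i == j then x else 0.
Proof. by move=> xj; rewrite -xj gprK xj. Qed.

Lemma gpr_fin x : exists2 s : seq int, uniq s &
  forall i, i \notin s -> gpr i x = 0.
Proof.
have [s sh ->] := gpr_gen x.
exists (undup [seq p.1 | p <- s]); first exact: undup_uniq.
move=> i; rewrite mem_undup => nis; rewrite linear_sum big_seq big1 // => p ps.
rewrite (gpr_homog _ (sh p ps)); case: eqP => // eip.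
by rewrite eip map_f in nis.
Qed.

Lemma homog_ind (T : A -> Prop) : T 0 -> (forall x y, T x -> T y -> T (x + y)) ->
  (forall i x, gpr i x = x -> T x) -> forall x, T x.
Proof.
move=> T0 TD Th x; have [s sh ->] := gpr_gen x.
rewrite big_seq; apply: big_ind => // p ps; exact: Th (sh p ps).
Qed.

(* The linear map with value F i x on the elements x of degree i. *)
Definition hsum (W : lmodType Q) (F : int -> A -> W) (x : A) : W :=
  \sum_(i \in [set: int]) F i (gpr i x).

Section Hsum.
Variables (W : lmodType Q) (F : int -> A -> W).
Hypothesis Flin : forall i, linear (F i).

Fact lin0 (U V : lmodType Q) (f : U -> V) : linear f -> f 0 = 0.
Proof. by move=> lf; have := lf (-1) 0 0; rewrite scaler0 add0r scaleN1r addNr. Qed.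

Lemma hsumE x (s : seq int) : uniq s -> (forall i, i \notin s -> gpr i x = 0) ->
  hsum F x = \sum_(i <- s) F i (gpr i x).
Proof.
move=> us hs; rewrite /hsum (fsbigE s) //=; last first.
  by move=> i _ nis; rewrite hs // lin0.
by apply: eq_bigl => i; rewrite in_setT.
Qed.

Lemma hsum_linear : linear (hsum F).
Proof.
move=> a x y; have [s us hs] := gpr_fin x; have [t ut ht] := gpr_fin y.
have uu : uniq (undup (s ++ t)) by exact: undup_uniq.
have zx i : i \notin undup (s ++ t) -> gpr i x = 0.
  by rewrite mem_undup mem_cat negb_or => /andP[/hs].
have zy i : i \notin undup (s ++ t) -> gpr i y = 0.
  by rewrite mem_undup mem_cat negb_or => /andP[_ /ht].
rewrite (hsumE uu zx) (hsumE uu zy) (hsumE uu) => [|i nis]; last first.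
  by rewrite linearP zx // zy // scaler0 add0r.
rewrite scaler_sumr -big_split; apply: eq_bigr => i _ /=.
by rewrite linearP Flin.
Qed.

Lemma hsum_homog i x : gpr i x = x -> hsum F x = F i x.
Proof.
move=> xi; rewrite (@hsumE _ [:: i]) ?big_seq1 ?xi //.
move=> j; rewrite inE => ji; rewrite (gpr_homog _ xi); by rewrite (negPf ji).
Qed.
End Hsum.

Lemma gpr_sum x (s : seq int) : uniq s ->
  (forall i, i \notin s -> gpr i x = 0) -> x = \sum_(i <- s) gpr i x.
Proof.
have Flin (i : int) : linear (@id A) by [].
move=> us hs; rewrite -(hsumE Flin us hs).
move: x {hs}; apply: homog_ind => [|x y {1}-> {1}->|i x xi].
- by rewrite (lin0 (hsum_linear Flin)).
- by have := hsum_linear Flin 1 x y; rewrite !scale1r.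
- by rewrite (hsum_homog Flin xi).
Qed.
End GradedTheory.

Section TensorGraded.
Variables (Q : comNzRingType) (A B : gmod Q).

Lemma tens0l y : tens 0 y = 0 :> tensor A B.
Proof. by apply: (@lin0 Q A _ (fun x => tens x y)); exact: (tens_bilin A B).1. Qed.
Lemma tens0r x : tens x 0 = 0 :> tensor A B.
Proof. by apply: (@lin0 Q B _ (tens x)); exact: (tens_bilin A B).2. Qed.
Lemma tensDl x x' y : tens (x + x') y = tens x y + tens x' y :> tensor A B.
Proof. by have := (tens_bilin A B).1 y 1 x x'; rewrite !scale1r. Qed.
Lemma tensDr x y y' : tens x (y + y') = tens x y + tens x y' :> tensor A B.
Proof. by have := (tens_bilin A B).2 x 1 y y'; rewrite !scale1r. Qed.
Lemma tensZl a x y : tens (a *: x) y = a *: tens x y :> tensor A B.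
Proof. by have := (tens_bilin A B).1 y a x 0; rewrite tens0l !addr0. Qed.
Lemma tensZr a x y : tens x (a *: y) = a *: tens x y :> tensor A B.
Proof. by have := (tens_bilin A B).2 x a y 0; rewrite tens0r !addr0. Qed.

Lemma tensor_ind (T : tensor A B -> Prop) :
  T 0 -> (forall s t, T s -> T t -> T (s + t)) ->
  (forall i j x y, gpr i x = x -> gpr j y = y -> T (tens x y)) ->
  forall t, T t.
Proof.
move=> T0 TD Th t; have [s ->] := tens_sum t.
apply: big_ind => // -[x y] _ /=.
move: x; apply: homog_ind => [|x x' Tx Tx'|i x xi].
- by rewrite tens0l.
- by rewrite tensDl; exact: TD.
move: y; apply: homog_ind => [|y y' Ty Ty'|j y yj].
- by rewrite tens0r.
- by rewrite tensDr; exact: TD.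
exact: Th xi yj.
Qed.

(* The projection onto degree n maps x (x) y, with x and y of degrees i and j,
   to x (x) y if n = i + j and to 0 otherwise; see [tprE]. *)
Definition tpr_fun (n : int) (x : A) (y : B) : tensor A B :=
  hsum (fun i x' => tens x' (gpr (n - i) y)) x.

Fact tpr_bilin n : bilin (tpr_fun n).
Proof.
have lin y i : linear (fun x' => tens x' (gpr (n - i) y) : tensor A B).
  by move=> a x x'; rewrite tensDl tensZl.
split=> [y|x]; first exact: hsum_linear.
move=> a y y'; have [s us hs] := gpr_fin x.
rewrite /tpr_fun !(@hsumE _ _ _ _ _ x s) // scaler_sumr -big_split.
by apply: eq_bigr => i _; rewrite linearP tensDr tensZr.
Qed.

Definition tpr (n : int) : {linear tensor A B -> tensor A B} :=
  tlift (tpr_bilin n).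

Lemma tprE n i j x y : gpr i x = x -> gpr j y = y ->
  tpr n (tens x y) = if n == i + j then tens x y else 0.
Proof.
move=> xi yj; rewrite /tpr /= tliftE /tpr_fun (hsum_homog _ xi); last first.
  by move=> k a u u'; rewrite tensDl tensZl.
by rewrite (gpr_homog _ yj) subr_eq addrC; case: eqP; rewrite ?tens0r.
Qed.

Fact tprK m n t : tpr m (tpr n t) = if m == n then tpr n t else 0.
Proof.
move: t; apply: tensor_ind => [|s t IHs IHt|i j x y xi yj].
- by rewrite !linear0 if_same.
- by rewrite !linearD IHs IHt /=; case: eqP; rewrite ?addr0.
rewrite (tprE _ xi yj); case: eqP => [->|ne].
- by rewrite (tprE _ xi yj).
- by rewrite linear0 if_same.
Qed.

Fact tpr_gen t : exists2 s : seq (int * tensor A B),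
  {in s, forall p, tpr p.1 p.2 = p.2} & t = \sum_(p <- s) p.2.
Proof.
move: t; apply: tensor_ind => [|u v [s sh ->] [t th ->]|i j x y xi yj].
- by exists [::]; rewrite ?big_nil.
- exists (s ++ t); last by rewrite big_cat.
  by move=> p; rewrite mem_cat => /orP[/sh|/th].
exists [:: (i + j, tens x y)]; last by rewrite big_seq1.
by move=> p; rewrite inE => /eqP->; rewrite (tprE _ xi yj) eqxx.
Qed.

Definition tensor_gmod : gmod Q := GMod tprK tpr_gen.
End TensorGraded.

Section TensorComplex.
Variables (Q : comNzRingType) (A B : complex Q).

Definition gsign (x : A) : A := hsum (fun i x' => (-1) ^+ `|i|%N *: x') x.

Fact gsign_linear : linear gsign.
Proof.
apply: hsum_linear => i a x y.
by rewrite scalerDr !scalerA mulrC.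
Qed.
HB.instance Definition _ := GRing.isLinear.Build Q A A _ gsign gsign_linear.

Lemma gsignE i x : gpr i x = x -> gsign x = (-1) ^+ `|i|%N *: x.
Proof.
move=> xi; rewrite /gsign (hsum_homog _ xi) // => j a u v.
by rewrite scalerDr !scalerA mulrC.
Qed.

Lemma cd_homog (C : complex Q) i (x : C) : gpr i x = x ->
  gpr (i - 1) (cd x) = cd x.
Proof. by move=> xi; rewrite -cd_deg xi. Qed.

Definition td_fun (x : A) (y : B) : tensor A B :=
  tens (cd x) y + tens (gsign x) (cd y).

Fact td_bilin : bilin td_fun.
Proof.
rewrite /td_fun; split=> [y a x x'|x a y y'].
- by rewrite !linearP !tensDl !tensZl scalerDr addrACA.
- by rewrite !linearP !tensDr !tensZr scalerDr addrACA.
Qed.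

Definition td : {linear tensor A B -> tensor A B} := tlift td_bilin.

Lemma tdE x y : td (tens x y) = tens (cd x) y + tens (gsign x) (cd y).
Proof. exact: tliftE. Qed.

Lemma gsign_cd (x : A) : gsign (cd x) = - cd (gsign x).
Proof.
move: x; apply: homog_ind => [|x y Hx Hy|i x xi].
- by rewrite !linear0.
- by rewrite [cd (x + y)]linearD [gsign (x + y)]linearD [cd (_ + _)]linearD
    opprD /= -Hx -Hy linearD.
rewrite (gsignE xi) (gsignE (cd_homog xi)) linearZ /= -scaleNr.
congr (_ *: _); case: i {xi} => [[|n]|n].
- by rewrite sub0r abszN /= expr0 expr1.
- by rewrite -[n.+1]addn1 PoszD addrK /= addn1 exprS mulN1r opprK.
- by rewrite NegzE -opprD !abszN -PoszD /= addn1 exprS mulN1r.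
Qed.

Fact td_td t : td (td t) = 0.
Proof.
move: t; apply: tensor_ind => [|s t IHs IHt|i j x y _ _].
- by rewrite !linear0.
- by rewrite !linearD IHs IHt addr0.
rewrite !tdE linearD /= !tdE !cdd tens0l tens0r add0r addr0 gsign_cd.
by rewrite -scaleN1r tensZl scaleN1r addNr.
Qed.

Fact td_deg n t : td (tpr A B n t) = tpr A B (n - 1) (td t).
Proof.
move: t; apply: tensor_ind => [|s t IHs IHt|i j x y xi yj].
- by rewrite !linear0.
- by rewrite !linearD IHs IHt.
have sxi : gpr i (gsign x) = gsign x by rewrite (gsignE xi) linearZ xi.
rewrite (tprE _ xi yj) !tdE linearD /= (tprE _ (cd_homog xi) yj).
have E : (n - 1 == i + j - 1) = (n == i + j) by apply: (inj_eq (addIr _)).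
rewrite (tprE _ sxi (cd_homog yj)) addrA (addrAC i (-1)) !E.
by case: eqP; rewrite ?tdE // linear0 addr0.
Qed.

Definition tensor_complex : complex Q :=
  @Complex Q (tensor_gmod A B) td td_td td_deg.
End TensorComplex.

Section Homology.
Variables (Q : comNzRingType) (C : complex Q).

Definition cycle : {pred C} := fun x => cd x == 0.

Fact cycle_submod : GRing.subsemimod_closed cycle.
Proof.
split; first split.
- by rewrite unfold_in linear0.
- by move=> x y; rewrite !unfold_in linearD => /eqP-> /eqP->; rewrite addr0.
- by move=> a x; rewrite !unfold_in linearZ /= => /eqP->; rewrite scaler0.
Qed.
HB.instance Definition _ := GRing.isSubmodClosed.Build Q C cycle cycle_submod.

Record cycles := Cycle { cval : C; cvalP : cval \in cycle }.
HB.instance Definition _ := [isSub for cval].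
HB.instance Definition _ := [Choice of cycles by <:].
HB.instance Definition _ := [SubChoice_isSubLmodule of cycles by <:].

Definition boundary : {pred cycles} := fun z => `[< exists y, val z = cd y >].

Fact boundary_zmod : zmod_closed boundary.
Proof.
split; first by apply/asboolP; exists 0; rewrite linear0 raddf0.
move=> x y /asboolP[u xu] /asboolP[v yv]; apply/asboolP.
by exists (u - v); rewrite [RHS]linearB -xu -yv; exact: raddfB.
Qed.
HB.instance Definition _ := GRing.isZmodClosed.Build cycles boundary
  boundary_zmod.

Definition homology := Quotient.quot boundary.
HB.instance Definition _ := GRing.Zmodule.on homology.

Local Notation cls z := (\pi_homology z : homology).

Fact clsP (z w : cycles) : (exists y, val z - val w = cd y) -> cls z = cls w.
Proof.
move=> [y zw]; apply/eqP; rewrite piE Quotient.equivE.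
by apply/asboolP; exists y; rewrite raddfB.
Qed.

Fact cls_repr (z : cycles) : exists y, val (repr (cls z)) - val z = cd y.
Proof.
have : repr (cls z) - z \in boundary by rewrite Quotient.idealrBE reprK.
by move=> /asboolP[y yE]; exists y; rewrite -yE raddfB.
Qed.

Fact clsD z w : cls (z + w) = cls z + cls w.
Proof. exact: raddfD. Qed.

Definition hscale a (h : homology) : homology := cls (a *: repr h).

Fact hscaleE a z : hscale a (cls z) = cls (a *: z).
Proof.
apply: clsP; have [y yE] := cls_repr z; exists (a *: y).
by rewrite [RHS]linearZ_LR -yE scalerBr.
Qed.

Fact hscaleA a b h : hscale a (hscale b h) = hscale (a * b) h.
Proof. by rewrite -[h]reprK (hscaleE b) !hscaleE scalerA. Qed.
Fact hscale1 : left_id 1 hscale.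
Proof. by move=> h; rewrite -[h]reprK !hscaleE scale1r. Qed.
Fact hscaleDr : right_distributive hscale +%R.
Proof.
by move=> a h l; rewrite -[h]reprK -[l]reprK -clsD !hscaleE scalerDr clsD.
Qed.
Fact hscaleDl h : {morph hscale^~ h : a b / a + b}.
Proof. by move=> a b; rewrite -[h]reprK !hscaleE scalerDl clsD. Qed.
HB.instance Definition _ := GRing.Zmodule_isLmodule.Build Q homology
  hscaleA hscale1 hscaleDr hscaleDl.

Fact gpr_cycle i (x : C) : x \in cycle -> gpr i x \in cycle.
Proof. by rewrite !unfold_in cd_deg => /eqP->; rewrite linear0. Qed.

Definition cpr i (z : cycles) : cycles := Cycle (gpr_cycle i (cvalP z)).

Fact clsZ a z : cls (a *: z) = a *: cls z.
Proof. by rewrite -hscaleE. Qed.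

Definition hpr_fun i (h : homology) : homology := cls (cpr i (repr h)).

Fact hpr_funE i z : hpr_fun i (cls z) = cls (cpr i z).
Proof.
apply: clsP; have [y yE] := cls_repr z; exists (gpr (i + 1) y).
by rewrite /= -linearB yE cd_deg addrK.
Qed.

Fact hpr_linear i : linear (hpr_fun i).
Proof.
move=> a h l; rewrite -[h]reprK -[l]reprK.
rewrite -clsZ -clsD !hpr_funE -clsZ -clsD; congr (cls _).
by apply: val_inj; rewrite /= !linearP.
Qed.
HB.instance Definition _ i :=
  GRing.isLinear.Build Q homology homology _ (hpr_fun i) (hpr_linear i).
Definition hpr i : {linear homology -> homology} := hpr_fun i.

Fact hprK i j h : hpr i (hpr j h) = if i == j then hpr j h else 0.
Proof.
rewrite -[h]reprK /hpr /= (hpr_funE j) hpr_funE; case: eqP => [->|/eqP ij].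
  by congr (cls _); apply: val_inj; rewrite /= gprK eqxx.
rewrite -(raddf0 (\pi_homology)); congr (cls _).
by apply: val_inj; rewrite /= gprK (negPf ij).
Qed.

Fact hpr_gen h : exists2 s : seq (int * homology),
  {in s, forall p, hpr p.1 p.2 = p.2} & h = \sum_(p <- s) p.2.
Proof.
rewrite -[h]reprK; set z := repr h; have [s us hs] := gpr_fin (val z).
exists [seq (i, cls (cpr i z)) | i <- s].
  move=> _ /mapP[i _ ->] /=; rewrite /hpr /= hpr_funE; congr (cls _).
  by apply: val_inj; rewrite /= gprK eqxx.
have zE : z = \sum_(i <- s) cpr i z.
  by apply: val_inj; rewrite raddf_sum; exact: gpr_sum us hs.
rewrite big_map {1}zE; exact: (raddf_sum (\pi_homology)).
Qed.

Definition homology_gmod : gmod Q := GMod hprK hpr_gen.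
End Homology.

Section Restriction.
Variables (Q R : comNzRingType) (phi : {rmorphism Q -> R}).

Definition restr (_ : {rmorphism Q -> R}) (M : lmodType R) : Type := M.

Section Module.
Variable M : lmodType R.
HB.instance Definition _ := GRing.Zmodule.copy (restr phi M) M.

Definition restr_scale (a : Q) (x : restr phi M) : restr phi M :=
  phi a *: (x : M).

Fact restr_scaleA a b x :
  restr_scale a (restr_scale b x) = restr_scale (a * b) x.
Proof. by rewrite /restr_scale scalerA rmorphM. Qed.
Fact restr_scale1 : left_id 1 restr_scale.
Proof. by move=> x; rewrite /restr_scale rmorph1 scale1r. Qed.
Fact restr_scaleDr : right_distributive restr_scale +%R.
Proof. by move=> a x y; exact: scalerDr. Qed.
Fact restr_scaleDl x : {morph restr_scale^~ x : a b / a + b}.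
Proof. by move=> a b; rewrite /restr_scale rmorphD scalerDl. Qed.
HB.instance Definition _ := GRing.Zmodule_isLmodule.Build Q (restr phi M)
  restr_scaleA restr_scale1 restr_scaleDr restr_scaleDl.
End Module.

Definition restr_map (M N : lmodType R) (f : {linear M -> N}) :
  restr phi M -> restr phi N := f.

Fact restr_map_linear (M N : lmodType R) (f : {linear M -> N}) : linear (restr_map f).
Proof. by move=> a x y; exact: (linearP f). Qed.
HB.instance Definition _ (M N : lmodType R) (f : {linear M -> N}) := GRing.isLinear.Build
  Q (restr phi M) (restr phi N) _ (restr_map f) (restr_map_linear f).

Definition restr_gmod (A : gmod R) : gmod Q :=
  @GMod Q (restr phi A) (fun i => restr_map (gpr i)) (@gprK R A) (@gpr_gen R A).

Definition restr_complex (M : complex R) : complex Q :=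
  @Complex Q (restr_gmod M) (restr_map cd) (@cdd R M) (@cd_deg R M).
End Restriction.

(* A module over Q that is annihilated by the kernel of a surjection Q -> k is
   a module over k. *)
Section Descent.
Variables (Q k : comNzRingType) (phi : {rmorphism Q -> k}).
Hypothesis phi_surj : forall c, exists a, phi a = c.

Definition annihilated (X : lmodType Q) : Prop :=
  forall a (x : X), phi a = 0 -> a *: x = 0.

Definition descent (X : lmodType Q) (_ : annihilated X)
  (_ : forall c, exists a, phi a = c) : Type := X.

Section Module.
Variables (X : lmodType Q) (annX : annihilated X).
Local Notation D := (descent annX phi_surj).
HB.instance Definition _ := GRing.Zmodule.copy D X.

Definition descent_scale (c : k) (x : D) : D :=
  sval (cid (phi_surj c)) *: (x : X).

Fact descent_scaleE a x : descent_scale (phi a) x = a *: (x : X).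
Proof.
rewrite /descent_scale; case: cid => b /= ba.
apply/eqP; rewrite -subr_eq0 -scalerBl; apply/eqP; apply: annX.
by rewrite rmorphB ba subrr.
Qed.

Fact descent_scaleA b c x :
  descent_scale b (descent_scale c x) = descent_scale (b * c) x.
Proof.
have [[u <-] [v <-]] := (phi_surj b, phi_surj c).
by rewrite -rmorphM !descent_scaleE scalerA.
Qed.
Fact descent_scale1 : left_id 1 descent_scale.
Proof. by move=> x; rewrite -(rmorph1 phi) descent_scaleE scale1r. Qed.
Fact descent_scaleDr : right_distributive descent_scale +%R.
Proof. by move=> a x y; exact: scalerDr. Qed.
Fact descent_scaleDl x : {morph descent_scale^~ x : a b / a + b}.
Proof.
move=> b c; have [[u <-] [v <-]] := (phi_surj b, phi_surj c).
by rewrite -rmorphD !descent_scaleE scalerDl.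
Qed.
HB.instance Definition _ := GRing.Zmodule_isLmodule.Build k D
  descent_scaleA descent_scale1 descent_scaleDr descent_scaleDl.
End Module.

Section Map.
Variables (X : lmodType Q) (annX : annihilated X) (f : {linear X -> X}).

Definition descent_map : descent annX phi_surj -> descent annX phi_surj := f.

Fact descent_map_linear : linear descent_map.
Proof. by move=> c x y; exact: (linearP f). Qed.
HB.instance Definition _ := GRing.isLinear.Build k
  (descent annX phi_surj) (descent annX phi_surj) _ descent_map
  descent_map_linear.
End Map.

Definition descent_gmod (A : gmod Q) (annA : annihilated A) : gmod k :=
  @GMod k (descent annA phi_surj) 
    (fun i => @descent_map A annA (gpr i)) (@gprK Q A) (@gpr_gen Q A).
End Descent.

Definition projective (Q : comNzRingType) (X : lmodType Q) : Prop :=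
  forall (A B : lmodType Q) (g : {linear A -> B}) (f : {linear X -> B}),
  (forall b, exists a, g a = b) ->
  exists h : {linear X -> A}, forall x, g (h x) = f x.

(* The total module of a complex is projective if and only if each of its
   components is. The last three fields say that
   ... -> F_1 -> F_0 -> L -> 0 is exact. *)
Record proj_resolution (Q : comNzRingType) (L : lmodType Q) :=
  ProjResolution {
  rcomplex :> complex Q;
  raug : {linear rcomplex -> L};
  r_proj : projective rcomplex;
  r_neg : forall i (x : rcomplex), i < 0 -> gpr i x = 0;
  raug_deg : forall i (x : rcomplex), i != 0 -> raug (gpr i x) = 0;
  raug_surj : forall y, exists x, raug x = y;
  raug_cd : forall x, raug (cd x) = 0;
  r_exact : forall x, cd x = 0 -> raug x = 0 -> exists y, x = cd y
}.

Arguments raug {Q L} p.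
Arguments r_proj {Q L} p.
Arguments r_neg {Q L} p i x _.

Section ProjectiveLift.
Variables (Q : comNzRingType) (A B : lmodType Q) (g : {linear A -> B}).

Definition im_pred : {pred B} := fun b => `[< exists a, g a = b >].

Fact im_submod : GRing.subsemimod_closed im_pred.
Proof.
split; first split.
- by apply/asboolP; exists 0; rewrite linear0.
- move=> _ _ /asboolP[x <-] /asboolP[y <-]; apply/asboolP.
  by exists (x + y); rewrite linearD.
- move=> a _ /asboolP[x <-]; apply/asboolP.
  by exists (a *: x); rewrite linearZ.
Qed.
HB.instance Definition _ := GRing.isSubmodClosed.Build Q B im_pred im_submod.

Record im_type := Im { im_val : B; im_valP : im_val \in im_pred }.
HB.instance Definition _ := [isSub for im_val].
HB.instance Definition _ := [Choice of im_type by <:].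
HB.instance Definition _ := [SubChoice_isSubLmodule of im_type by <:].

Section Corestrict.
Variables (X : lmodType Q) (f : {linear X -> B}).
Hypothesis fg : forall x, f x \in im_pred.
Definition corestr x : im_type := Im (fg x).
Fact corestr_linear : linear corestr.
Proof. by move=> a x y; apply: val_inj; rewrite /= linearP. Qed.
HB.instance Definition _ :=
  GRing.isLinear.Build Q X im_type _ corestr corestr_linear.
End Corestrict.

Lemma projective_lift (X : lmodType Q) (f : {linear X -> B}) :
  projective X -> (forall x, exists a, g a = f x) ->
  exists h : {linear X -> A}, forall x, g (h x) = f x.
Proof.
move=> projX fg.
have fI x : f x \in im_pred by apply/asboolP.
have gI a : g a \in im_pred by apply/asboolP; exists a.
have [|h hE] := projX A im_type (corestr gI) (corestr fI).
  by move=> [b bI]; have /asboolP[a ab] := bI; exists a; apply: val_inj.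
by exists h => x; have /(congr1 val) := hE x.
Qed.
End ProjectiveLift.

(* If q annihilates L, then multiplication by q is null-homotopic on every
   projective resolution of L. *)
Section Homotopy.
Variables (Q : comNzRingType) (L : lmodType Q) (F : proj_resolution L) (q : Q).
Hypothesis qL : forall y : L, q *: y = 0.

Definition nullhtpy_at (n : nat) (t : {linear F -> F}) : Prop :=
  (forall x, gpr n%:Z (t x) = t x) /\
  (forall x, cd (t (cd (gpr n%:Z x))) = q *: cd (gpr n%:Z x)).

Definition nullhtpy_step n (t t' : {linear F -> F}) : Prop :=
  forall x, cd (t' x) = q *: gpr n%:Z x - t (cd (gpr n%:Z x)).

Fact cd_gpr0 (x : F) : cd (gpr 0 x) = 0.
Proof. by rewrite cd_deg r_neg. Qed.

Fact nullhtpy_next n t : nullhtpy_at n t ->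
  exists t', nullhtpy_at n.+1 t' /\ nullhtpy_step n t t'.
Proof.
move=> [tdeg tcd].
pose w x := q *: gpr n%:Z x - t (cd (gpr n%:Z x)).
have w_lin : linear w.
  move=> a x y; rewrite /w [gpr _ (_ + _)]linearP [cd (_ + _)]linearP [t (_ + _)]linearP.
  by rewrite scalerDr scalerBr !scalerA (mulrC q) opprD addrACA.
pose wH := GRing.isLinear.Build Q F F _ w w_lin.
pose wl : {linear F -> F} := HB.pack w wH.
have w_deg x : gpr n%:Z (w x) = w x.
  by rewrite /w linearB tdeg linearZ /= gprK eqxx.
have w_cd x : cd (w x) = 0.
  by rewrite /w linearB linearZ /= tcd subrr.
have w_aug x : raug F (w x) = 0.
  case: n => [|n] in t tdeg tcd w w_lin wH wl w_deg w_cd *.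
    by rewrite /w cd_gpr0 linear0 subr0 linearZ /= qL.
  by rewrite -w_deg raug_deg.
have [|h hE] := projective_lift (g := cd) (f := wl) (r_proj F).
  by move=> x; have [y yE] := r_exact (w_cd x) (w_aug x); exists y.
pose t' x := gpr n.+1%:Z (h x).
have t'_lin : linear t' by move=> a x y; rewrite /t' !linearP.
pose tH := GRing.isLinear.Build Q F F _ t' t'_lin.
pose tl : {linear F -> F} := HB.pack t' tH.
have step : nullhtpy_step n t tl.
  move=> x; rewrite /= /t' cd_deg hE -[n.+1]addn1 PoszD addrK; exact: w_deg.
exists tl; split=> //; split=> x; first by rewrite /= /t' gprK eqxx.
have -> : cd (gpr n.+1%:Z x) = gpr n%:Z (cd x).
  by rewrite cd_deg -addn1 PoszD addrK.
rewrite step gprK eqxx; set y := cd (gpr n%:Z (cd x)).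
have -> : y = 0 by rewrite /y cd_deg cdd linear0.
by rewrite linear0 subr0.
Qed.

Lemma nullhtpy : exists s : {linear F -> F},
  (forall i x, gpr i x = x -> gpr (i + 1) (s x) = s x) /\
  forall x, cd (s x) + s (cd x) = q *: x.
Proof.
have z_lin : linear (fun _ : F => 0 : F).
  by move=> a x y; rewrite scaler0 addr0.
pose zH := GRing.isLinear.Build Q F F _ (fun _ : F => 0 : F) z_lin.
pose z : {linear F -> F} := HB.pack (fun _ : F => 0 : F) zH.
have z0 : nullhtpy_at 0 z.
  by split=> x /=; rewrite ?cd_gpr0 ?linear0 ?scaler0.
pose T n := {t | nullhtpy_at n t}.
have nxt n (t : T n) :
    {t' : T n.+1 | nullhtpy_step n (sval t) (sval t')}.
  case: t => t /= /nullhtpy_next/cid[t' [t'1 t'2]].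
  by exists (exist _ t' t'1).
pose ts n : T n :=
  nat_rect T (exist _ z z0) (fun m t => sval (nxt m t)) n.
have tsE n x : cd (sval (ts n.+1) x) =
    q *: gpr n%:Z x - sval (ts n) (cd (gpr n%:Z x)).
  exact: (svalP (nxt n (ts n))).
pose G (i : int) : {linear F -> F} := if i is Posz n then sval (ts n.+1) else z.
have Glin i : linear (G i) by move=> a x y; rewrite linearP.
have slin := hsum_linear Glin.
pose sH := GRing.isLinear.Build Q F F _ (hsum (fun i => G i)) slin.
pose s : {linear F -> F} := HB.pack (hsum (fun i => G i)) sH.
have sE i x : gpr i x = x -> s x = G i x by move=> xi; exact: hsum_homog.
exists s; split=> [i x xi|].
  rewrite (sE _ _ xi); case: i {xi} => n /=; last by rewrite linear0.
  by rewrite -PoszD addn1; have [] := svalP (ts n.+1).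
apply: homog_ind => [|x y Hx Hy|i x xi].
- by rewrite !linear0 addr0.
- rewrite [s (x + y)]linearD [cd (x + y)]linearD [cd (_ + _)]linearD.
  by rewrite [s (_ + _)]linearD scalerDr -Hx -Hy addrACA.
case: i xi => [n|n] xi; last by rewrite -xi r_neg // !linear0 addr0.
rewrite (sE _ _ xi) (sE _ _ (cd_homog xi)) /G tsE xi.
case: n xi => [|n] xi; first by rewrite -xi cd_gpr0 !linear0 !addr0.
have -> : n.+1%:Z - 1 = n%:Z by rewrite -addn1 PoszD addrK.
by rewrite subrK.
Qed.
End Homotopy.

Section Tor.
Variables (Q k : comNzRingType) (phi : {rmorphism Q -> k}).
Hypothesis phi_surj : forall c, exists a, phi a = c.
Variables (F : proj_resolution (restr phi k^o)) (M : complex Q).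

Fact tor_annihilated :
  annihilated phi (homology_gmod (tensor_complex F M)).
Proof.
move=> q h q0; have [y|s [s_deg sE]] := @nullhtpy _ _ F q.
  by rewrite -[_ *: _]/(phi q *: (y : k^o)) q0 scale0r.
pose b (x : F) (y : M) : tensor F M := tens (s x) y.
have bb : bilin b.
  rewrite /b; split=> [y a x x'|x a y y'].
    by rewrite linearP tensDl tensZl.
  by rewrite tensDr tensZr.
have gs x : gsign (s x) = - s (gsign x).
  move: x; apply: homog_ind => [|x y Hx Hy|i x xi].
  - by rewrite !linear0.
  - by rewrite [s (x + y)]linearD [gsign (x + y)]linearD [s (_ + _)]linearD
      opprD /= -Hx -Hy linearD.
  rewrite (gsignE (s_deg _ _ xi)) (gsignE xi) linearZ /= -scaleNr.
  congr (_ *: _); case: i {xi} => [n|[|n]].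
  - by rewrite -PoszD addn1 !absz_nat exprS mulN1r.
  - by rewrite NegzE addNr /= expr0 expr1 opprK.
  - have -> : Negz n.+1 + 1 = - n.+1%:Z.
      by rewrite NegzE -[n.+2]addn1 PoszD opprD addrNK.
    by rewrite NegzE !abszN !absz_nat [in RHS]exprS mulN1r opprK.
have htpy t : td F M (tlift bb t) + tlift bb (td F M t) = q *: t.
  move: t; apply: tensor_ind => [|u v Hu Hv|i j x y _ _].
  - by rewrite !linear0 addr0.
  - rewrite [td _ _ (_ + _)]linearD [tlift bb (u + v)]linearD.
    rewrite [td _ _ (_ + _)]linearD [tlift bb (_ + _)]linearD.
    by rewrite scalerDr -Hu -Hv addrACA.
  rewrite tliftE !tdE linearD /= !tliftE /b gs addrACA -!tensDl sE.
  by rewrite addNr tens0l addr0 tensZl.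
rewrite -[h]reprK -clsZ -[RHS](raddf0 (\pi_(homology _))); apply: clsP.
exists (tlift bb (val (repr h))); rewrite !raddf0 addr0.
have := cvalP (repr h); rewrite unfold_in => /eqP dz.
by rewrite linearZ_LR -htpy /= dz linear0 addr0.
Qed.

(* Tor^Q(k, M) is the homology of F (x)_Q M, where k, a quotient of Q, is
   resolved over Q by F; it is annihilated by the kernel of Q -> k. *)
Definition tor : gmod k := descent_gmod phi_surj tor_annihilated.
End Tor.

(* The graded module underlying the divided power algebra k<y>, |y| = 2, with
   'X^i standing for y^(i): the basis element 'X^i has degree 2i. *)
Section DividedPower.
Variable k : comNzRingType.

Definition dp_fun (i : int) (p : {poly k}) : {poly k} :=
  if i is Posz m then if odd m then 0 else p`_(m./2) *: 'X^(m./2) else 0.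

Fact dp_linear i : linear (dp_fun i).
Proof.
move=> a p q; rewrite /dp_fun; case: i => [m|m]; last by rewrite scaler0 addr0.
case: ifP => _; first by rewrite scaler0 addr0.
by rewrite coefD coefZ scalerDl scalerA.
Qed.
HB.instance Definition _ i :=
  GRing.isLinear.Build k {poly k} {poly k} _ (dp_fun i) (dp_linear i).
Definition dp_pr i : {linear {poly k} -> {poly k}} := dp_fun i.

Lemma dp_funE i n : dp_fun i 'X^n = if i == n.*2%:Z then 'X^n else 0.
Proof.
rewrite /dp_fun; case: i => [m|m] //.
rewrite eqz_nat -[m in m == _]odd_double_half; case: (odd m) => /=.
  case: eqP => // /(congr1 odd); by rewrite oddD !odd_double.
rewrite add0n (inj_eq double_inj) coefXn; case: eqP => [->|_].
  by rewrite scale1r.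
by rewrite scale0r.
Qed.

Fact dp_prK i j p : dp_pr i (dp_pr j p) = if i == j then dp_pr j p else 0.
Proof.
rewrite /dp_pr /= -[p]coefK poly_def !linear_sum /=; case: eqP => [->|/eqP ij].
  apply: eq_bigr => n _; rewrite [dp_fun j (_ *: _)]linearZ_LR linearZ_LR.
  by rewrite /= dp_funE; case: eqP => [->|_]; rewrite ?dp_funE ?eqxx // linear0.
apply: big1 => n _; rewrite linearZ_LR linearZ_LR /= dp_funE.
case: eqP => [jn|_]; last by rewrite linear0 scaler0.
by rewrite dp_funE -jn (negPf ij) scaler0.
Qed.

Fact dp_gen p : exists2 s : seq (int * {poly k}),
  {in s, forall r, dp_pr r.1 r.2 = r.2} & p = \sum_(r <- s) r.2.
Proof.
exists [seq (i.*2%:Z, p`_i *: 'X^i) | i <- iota 0 (size p)].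
  move=> _ /mapP[i _ ->]; rewrite linearZ_LR /= odd_double doubleK coefXn.
  by rewrite eqxx scale1r.
rewrite big_map /= -{1}[p]coefK poly_def.
by rewrite -(big_mkord xpredT (fun i => p`_i *: 'X^i)) /index_iota subn0.
Qed.

Definition divided_power : gmod k := GMod dp_prK dp_gen.
End DividedPower.

Section QuotientTor.
Variables (P : comNzRingType) (n I : idealr P) (sIn : {subset I <= n}).
Variable M : complex {ideal_quot I}.
Local Notation k := {ideal_quot n}.

Section Hypersurface.
Variables (f : P) (If : f \in I).
Local Notation Pf := {ideal_quot (principal If)}.

Lemma principal_sub_max : {subset principal If <= n}.
Proof. by move=> x xf; apply: sIn; exact: (principal_sub If). Qed.

Definition residue_quot : lmodType Pf := restr (quot_map principal_sub_max) k^o.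

Definition tor_quot (F : proj_resolution residue_quot) : gmod k :=
  tor (quot_map_surj principal_sub_max) F
    (restr_complex (quot_map (principal_sub If)) M).
End Hypersurface.

Definition residue : lmodType P := restr (quot_proj n) k^o.

Definition tor_base (F : proj_resolution residue) : gmod k :=
  tor (@quot_proj_surj P n) F (restr_complex (quot_proj I) M).
End QuotientTor.

(* Main.v *)
(* Part (1): in a noetherian ring finitely many maximal annihilators, which are
   prime, contain all the zero divisors, so that f + a r^2 is regular for some
   a, by prime avoidance, if r in I is regular.

   Parts (2) and (3): let G be a projective resolution of k over P. A system of
   higher homotopies for f in n on G consists of operators s_i on G of degree
   2i - 1, with s_0 the differential, such that D = sum_i s_i t^i on G<y>, with
   t y^(m) = y^(m-1), squares to f t. If f is regular, then G<y>/f G<y> with the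
   differential D is a projective resolution of k over P/(f): if D x = f z and
   t y = z, then x' = x - D y satisfies D x' = 0, hence f t x' = D (D x') = 0 and
   t x' = 0, so that x' is a cycle of G. Therefore Tor over P/(f) is the homology
   of G<y> (x)_P M, and depends only on the action of the s_i modulo I. If a is
   in n, then a system for f extends to a two-parameter system with
   D^2 = f t + a T; the substitution T = b t gives a system for f + a b that
   agrees with the former modulo b. So systems for f and g that agree modulo I
   exist if f - g is in nI, which is (2). If f is in nI, then the system with
   s_i = 0 for i > 0, whose square is zero, agrees modulo I with a system for f,
   which is (3). *)

Require Import Defs.
From HB Require Import structures.
From mathcomp Require Import all_boot all_order all_algebra zify.
From mathcomp Require Import boolp classical_sets fsbigop.

Set Implicit Arguments.
Unset Strict Implicit.
Unset Printing Implicit Defensive.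

Import GRing.Theory.
Local Open Scope ring_scope.
Local Open Scope quotient_scope.

(** * Regular elements in cosets *)

(** Passing from [f] to [f + a * b] directly would call for corrections of the [s i] that are
    multiples of [b], hence for dividing by [b], which may be a zero divisor. With a formal variable
    T in place of [b], each monomial gives an equation of its own, solved by a null-homotopy, and
    powers of [b] appear only at the substitution. The same construction starts everything: the
    trivial system belongs to 0, and extending it with [a := g] and [b := 1] gives a system for [g].
    The rings P/(f) and P/(g) are in general not related by a map of P-algebras, so both sides of
    (2) are compared over P: reduction identifies the modules of both complexes with G<y> (x)_P M,
    and congruent systems induce the same differential on it. Isomorphisms are tracked as P-linear
    bijections, which are k-linear in the end because P -> k is onto. In (1) finiteness comes from a
    choice: among the ideals spanned by finitely many elements with maximal annihilators, take a
    largest one. *)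

Section RegularElements.
Variable P : comNzRingType.
Hypothesis noethP : noetherian P.

(** In [noetherian] the coefficient [c a] depends on the value of an entry and not on its position,
    so an entry occurring m times in [s] only contributes multiples of m a. The generators are
    therefore the distinct entries times their multiplicities. *)
Lemma noetherian_gens (J : set P) : is_ideal J ->
  exists2 s : seq P, {in s, forall a, J a} &
    forall K : set P, is_ideal K -> {in s, forall a, K a} ->
      forall x, J x -> K x.
Proof.
move=> /noethP[s sE]; pose e a := a *+ count_mem a s.
have eE c : \sum_(a <- s) c a * a = \sum_(a <- undup s) c a * e a.
  rewrite -big_undup_iterop_count; apply: eq_bigr => a _.
  by rewrite /e mulrnAr.
exists [seq e a | a <- undup s].
  move=> _ /mapP[a aus ->]; apply/sE; exists (fun b => (b == a)%:R).
  rewrite eE (bigD1_seq a) ?undup_uniq //= eqxx mul1r big1 ?addr0 // => b ba.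
  by rewrite (negPf ba) mul0r.
move=> K [K0 KD] sK _ /sE[c ->]; rewrite eE big_seq.
elim/big_ind: _ => // [x y Kx Ky|a aus]; first by rewrite -[x]mul1r; exact: KD.
by rewrite -[_ * _]addr0; apply: KD => //; apply: sK; exact: map_f.
Qed.

(** Without a maximal member, choice produces a strictly increasing sequence [u]; finitely many
    generators of its union already lie in one term, which the next term cannot exceed. *)
Lemma noetherian_max (F : set (set P)) J0 : F J0 ->
  (forall J, F J -> is_ideal J) ->
  exists2 J, F J & forall K, F K -> (forall x, J x -> K x) ->
    forall x, K x -> J x.
Proof.
move=> FJ0 Fid; apply: contrapT => nomax.
have nxt (J : {J | F J}) : {K : {J | F J} |
    (forall x, sval J x -> sval K x) /\ exists2 x, sval K x & ~ sval J x}.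
  apply: cid; apply: contrapT => noK; apply: nomax; exists (sval J) => [|K FK JK x Kx].
    exact: svalP J.
  by apply: contrapT => nJx; apply: noK; exists (exist _ K FK); split => //; exists x.
pose u := fix u m := if m is m'.+1 then sval (nxt (u m')) else exist _ J0 FJ0.
have umono m p x : (m <= p)%N -> sval (u m) x -> sval (u p) x.
  move=> /subnK<-; elim: (p - m)%N => // q IH /IH; exact: (svalP (nxt (u (q + m)))).1.
pose U : set P := fun x => exists m, sval (u m) x.
have Uid : is_ideal U.
  split; first by exists 0; exact: (Fid _ FJ0).1.
  move=> a x y [m mx] [p px]; exists (maxn m p).
  apply: (Fid _ (svalP (u _))).2.
    exact: umono (leq_maxl _ _) mx.
  exact: umono (leq_maxr _ _) px.
have [s sU sgen] := noetherian_gens Uid.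
have [m sm] : exists m, {in s, forall a, sval (u m) a}.
  elim: s sU {sgen} => [|a s IHs] sU; first by exists 0%N.
  have [|m sm] := IHs; first by move=> b bs; apply: sU; rewrite inE bs orbT.
  have [p pa] : U a by apply: sU; rewrite inE eqxx.
  exists (maxn m p) => b; rewrite inE => /orP[/eqP->|/sm].
    exact: umono (leq_maxr _ _) pa.
  exact: umono (leq_maxl _ _).
have [_ [x xu []]] := svalP (nxt (u m)).
by apply: sgen sm _ _; [exact: Fid (svalP (u m)) | exists m.+1].
Qed.

Definition annihilator (x : P) : set P := fun u => u * x = 0.

Lemma annihilator_ideal x : is_ideal (annihilator x).
Proof.
rewrite /annihilator; split=> [|a u v ux vx]; first by rewrite mul0r.
by rewrite mulrDl -mulrA ux vx mulr0 addr0.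
Qed.

(** The annihilators of such [x] are the maximal ones among annihilators of nonzero elements, hence
    associated primes of [P]. *)
Definition max_annihilator (x : P) : Prop := x != 0 /\
  forall y, y != 0 -> (forall u, u * x = 0 -> u * y = 0) ->
    forall u, u * y = 0 -> u * x = 0.

(** The annihilator of [v * x] contains that of [x], so by maximality the two agree. *)
Lemma max_annihilator_prime x u v : max_annihilator x ->
  u * v * x = 0 -> v * x != 0 -> u * x = 0.
Proof.
move=> [_ xmax] uvx vx; apply: (xmax _ vx) => [w wx|]; last by rewrite mulrA.
by rewrite mulrCA wx mulr0.
Qed.

(** A product of one witness per entry annihilates all of [s] and stays outside the annihilator of
    [x], which is prime. *)
Lemma max_annihilator_avoid x (s : seq P) : max_annihilator x ->
  {in s, forall y, exists2 u, u * y = 0 & u * x != 0} ->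
  exists2 u, {in s, forall y, u * y = 0} & u * x != 0.
Proof.
move=> mx; elim: s => [|y s IHs] ys.
  by exists 1 => //; rewrite mul1r; exact: mx.1.
have [|u us ux] := IHs; first by move=> z zs; apply: ys; rewrite inE zs orbT.
have [v vy vx] := ys y (mem_head _ _).
exists (v * u); last by apply: contra vx => /eqP vux; apply/eqP;
  exact: max_annihilator_prime mx vux ux.
move=> z; rewrite inE => /orP[/eqP->|/us uz]; last by rewrite -mulrA uz mulr0.
by rewrite mulrAC vy mul0r.
Qed.

Lemma zero_divisor_max_annihilator u v : v != 0 -> u * v = 0 ->
  exists2 x, max_annihilator x & u * x = 0.
Proof.
move=> v0 uv.
pose F : set (set P) := fun J => exists2 x, x != 0 /\ J = annihilator x & u * x = 0.
have [||_ [x [x0 ->] ux] xmax] := @noetherian_max F (annihilator v).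
- by exists v.
- by move=> _ [x [_ ->] _]; exact: annihilator_ideal.
exists x => //; split=> // y y0 xy w wy; apply: (xmax (annihilator y)) => //.
by exists y => //; exact: xy.
Qed.

Definition span (s : seq P) : set P := fun x =>
  forall K, is_ideal K -> {in s, forall a, K a} -> K x.

Lemma span_ideal s : is_ideal (span s).
Proof.
split=> [K [] //|a x y sx sy K Kid sK].
by apply: Kid.2; [exact: sx|exact: sy].
Qed.

(** If [x] has maximal annihilator and lies in the span of [s], some entry of [s] has the same
    annihilator: otherwise some element would annihilate [s] but not [x]. A span that cannot be
    enlarged contains every such [x]. *)
Lemma zero_divisors_finite : exists2 s : seq P,
  {in s, forall x, max_annihilator x} &
  forall u v, v != 0 -> u * v = 0 -> exists2 x, x \in s & u * x = 0.
Proof.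
pose F : set (set P) := fun J => exists2 s : seq P,
  {in s, forall x, max_annihilator x} & J = span s.
have [||_ [s sm ->] smax] := @noetherian_max F (span [::]).
- by exists [::].
- by move=> _ [s _ ->]; exact: span_ideal.
exists s => // u v v0 uv.
have [x mx ux] := zero_divisor_max_annihilator v0 uv.
have sx : span s x.
  apply: (smax (span (x :: s))) => [|y sy K Kid sK|K _ sK].
  - by exists (x :: s) => // y; rewrite inE => /orP[/eqP->|/sm].
  - by apply: sy => // z zs; apply: sK; rewrite inE zs orbT.
  - by apply: sK; rewrite inE eqxx.
apply: contrapT => nos.
have [|w ws /eqP[]] := @max_annihilator_avoid x s mx.
  move=> y ys; apply: contrapT => noy; apply: nos; exists y => //.
  apply: (sm _ ys).2 ux; first exact: mx.1.
  by move=> w wy; apply: contrapT => wx; apply: noy; exists w => //; apply/eqP.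
apply: (sx (fun z => w * z = 0)) => //; split; first by rewrite mulr0.
by move=> a y z wy wz; rewrite mulrDr mulrCA wy wz mulr0 addr0.
Qed.

Lemma coset_avoidance f r (s : seq P) : {in s, forall x, max_annihilator x} ->
  {in s, forall x, r * x != 0} ->
  exists a, {in s, forall x, (f + a * r) * x != 0}.
Proof.
elim: s => [|x s IHs] sm sr; first by exists 0.
have {}IHs : exists a, {in s, forall x, (f + a * r) * x != 0}.
  by apply: IHs => y ys; [apply: sm|apply: sr]; rewrite inE ys orbT.
have [a as_] := IHs; have mx := sm x (mem_head _ _).
have [fx|fx] := eqVneq ((f + a * r) * x) 0; last first.
  by exists a => y; rewrite inE => /orP[/eqP->|/as_].
(* [f + a * r] annihilates [x] but no [y] in [s], so by maximality no annihilator of such a [y] lies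
   in that of [x]; hence [b] exists in all of the former and outside the latter. Adding [b * r]
   changes nothing on [s]. *)
have [|b bs bx] := @max_annihilator_avoid x s mx.
  move=> y ys; apply: contrapT => noy; have /eqP[] := as_ y ys.
  have my : max_annihilator y by apply: sm; rewrite inE ys orbT.
  apply: my.2 fx; first exact: mx.1.
  by move=> w wy; apply: contrapT => wx; apply: noy; exists w => //; apply/eqP.
exists (a + b) => y; rewrite [(a + b) * r]mulrDl addrA [(_ + _) * y]mulrDl.
rewrite inE => /orP[/eqP->|ys]; last by rewrite -mulrA mulrCA bs // mulr0 addr0 as_.
rewrite fx add0r; apply: contra bx => /eqP brx; apply/eqP.
by apply: max_annihilator_prime mx brx _; exact: sr (mem_head _ _).
Qed.

Lemma regular_translate (f r : P) : GRing.lreg r -> exists a, GRing.lreg (f + a * r).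
Proof.
move=> rr; have [s sm szd] := zero_divisors_finite.
have [|a afs] := @coset_avoidance f r s sm.
  by move=> x /sm[x0 _]; rewrite mulrI_eq0.
exists a => v w /eqP; rewrite -subr_eq0 -mulrBr => /eqP fvw.
apply/eqP; rewrite -subr_eq0; apply: contrapT => /negP vw0.
by have [x /afs/eqP] := szd _ _ vw0 fvw.
Qed.

Lemma regular_coset (n I : idealr P) : {subset I <= n} ->
  (exists2 r, r \in I & GRing.lreg r) ->
  forall f, exists2 h, ideal_prod n I h & GRing.lreg (f + h).
Proof.
(* The square of [r] serves to land in nI: [a * (r * r)] is the product of [a * r], in [n], and [r],
   in [I]. *)
move=> sIn [r Ir rr] f; have [a regfa] := regular_translate f (lregM rr rr).
exists (a * (r * r)) => //; exists [:: (a * r, r)].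
  by move=> p; rewrite inE => /eqP-> /=; split=> //; apply: idealMr; exact: sIn.
by rewrite big_seq1 /= mulrA.
Qed.
End RegularElements.

(** * Direct sums *)

Definition linear_pack (Q : pzRingType) (U V : lmodType Q) (f : U -> V) (lf : linear f) :
  {linear U -> V} := HB.pack f (GRing.isLinear.Build Q U V _ f lf).

Section DirectSum.
Variables (Q : comNzRingType) (I : choiceType) (A : I -> lmodType Q).

Record dsum := DSum {
  dfun :> forall i, A i;
  dfin : exists s : seq I, forall i, i \notin s -> dfun i = 0
}.

Lemma dsumP (x y : dsum) : (forall i, x i = y i) -> x = y.
Proof.
case: x y => [f ff] [g gf] /= fg.
have {}fg : f = g by apply: functional_extensionality_dep.
by rewrite -fg in gf *; rewrite (Prop_irrelevance ff gf).
Qed.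

HB.instance Definition _ := gen_eqMixin dsum.
HB.instance Definition _ := gen_choiceMixin dsum.

Fact dsum0_fin : exists s : seq I, forall i, i \notin s -> (0 : A i) = 0.
Proof. by exists [::]. Qed.
Fact dsumD_fin (x y : dsum) :
  exists s : seq I, forall i, i \notin s -> x i + y i = 0.
Proof.
have [[s sx] [t ty]] := (dfin x, dfin y); exists (s ++ t) => i.
by rewrite mem_cat negb_or => /andP[/sx-> /ty->]; rewrite addr0.
Qed.
Fact dsumZ_fin a (x : dsum) :
  exists s : seq I, forall i, i \notin s -> a *: x i = 0.
Proof. by have [s sx] := dfin x; exists s => i /sx->; rewrite scaler0. Qed.

Definition dsum_zero := DSum dsum0_fin.
Definition dsum_add x y := DSum (dsumD_fin x y).
Definition dsum_scale a x := DSum (dsumZ_fin a x).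
Definition dsum_opp := dsum_scale (-1).

Fact dsum_addA : associative dsum_add.
Proof. by move=> x y z; apply: dsumP => i /=; rewrite addrA. Qed.
Fact dsum_addC : commutative dsum_add.
Proof. by move=> x y; apply: dsumP => i /=; rewrite addrC. Qed.
Fact dsum_add0 : left_id dsum_zero dsum_add.
Proof. by move=> x; apply: dsumP => i /=; rewrite add0r. Qed.
Fact dsum_addN : left_inverse dsum_zero dsum_opp dsum_add.
Proof. by move=> x; apply: dsumP => i /=; rewrite scaleN1r addNr. Qed.
HB.instance Definition _ :=
  GRing.isZmodule.Build dsum dsum_addA dsum_addC dsum_add0 dsum_addN.

Fact dsum_scaleA a b x : dsum_scale a (dsum_scale b x) = dsum_scale (a * b) x.
Proof. by apply: dsumP => i /=; rewrite scalerA. Qed.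
Fact dsum_scale1 : left_id 1 dsum_scale.
Proof. by move=> x; apply: dsumP => i /=; rewrite scale1r. Qed.
Fact dsum_scaleDr : right_distributive dsum_scale +%R.
Proof. by move=> a x y; apply: dsumP => i /=; rewrite scalerDr. Qed.
Fact dsum_scaleDl x : {morph dsum_scale^~ x : a b / a + b}.
Proof. by move=> a b; apply: dsumP => i /=; rewrite scalerDl. Qed.
HB.instance Definition _ := GRing.Zmodule_isLmodule.Build Q dsum
  dsum_scaleA dsum_scale1 dsum_scaleDr dsum_scaleDl.

Fact dproj_linear i : linear (fun x : dsum => x i).
Proof. by []. Qed.
Definition dproj i : {linear dsum -> A i} := linear_pack (dproj_linear i).

Lemma dsumDE (x y : dsum) i : (x + y) i = x i + y i. Proof. by []. Qed.
Lemma dsumZE a (x : dsum) i : (a *: x) i = a *: x i. Proof. by []. Qed.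
Lemma dsum0E i : (0 : dsum) i = 0. Proof. by []. Qed.
Lemma dsum_sumE (T : Type) (s : seq T) (F : T -> dsum) i :
  (\sum_(j <- s) F j) i = \sum_(j <- s) F j i.
Proof. exact: (linear_sum (dproj i)). Qed.

Fact dinj_fin i (a : A i) : exists s : seq I, forall j, j \notin s ->
  dfwith (fun j => 0 : A j) a j = 0.
Proof.
by exists [:: i] => j; rewrite inE eq_sym => ij; rewrite dfwith_out.
Qed.
Definition dinj_fun i (a : A i) : dsum := DSum (dinj_fin a).

Fact dinj_linear i : linear (@dinj_fun i).
Proof.
move=> c a b; apply: dsumP => j; rewrite dsumDE dsumZE /=.
have [ij|ij] := eqVneq i j; first by subst j; rewrite !dfwith_in.
by rewrite !dfwith_out // scaler0 addr0.
Qed.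
Definition dinj i : {linear A i -> dsum} := linear_pack (@dinj_linear i).

Lemma dinjE i (a : A i) : dinj i a i = a.
Proof. exact: dfwith_in. Qed.
Lemma dinj_neq i j (a : A i) : i != j -> dinj i a j = 0.
Proof. by move=> ij; rewrite /= dfwith_out. Qed.

Lemma dsum_expand (x : dsum) (s : seq I) : uniq s ->
  (forall i, i \notin s -> x i = 0) -> x = \sum_(i <- s) dinj i (x i).
Proof.
move=> us sx; apply: dsumP => i; rewrite dsum_sumE.
have [si|si] := boolP (i \in s).
  rewrite (bigD1_seq i) //= dfwith_in big1 ?addr0 // => j ji.
  by rewrite dfwith_out.
rewrite sx // big_seq big1 // => j js; rewrite dinj_neq //.
by apply: contraNneq si => <-.
Qed.

Lemma dsum_ind (T : dsum -> Prop) : T 0 ->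
  (forall x y, T x -> T y -> T (x + y)) -> (forall i a, T (dinj i a)) ->
  forall x, T x.
Proof.
move=> T0 TD Ti x; have [s sx] := dfin x.
rewrite (@dsum_expand x (undup s)) ?undup_uniq //; first exact: big_ind.
by move=> i; rewrite mem_undup; exact: sx.
Qed.

Section Lift.
Variables (W : lmodType Q) (h : forall i, {linear A i -> W}).

Definition dlift_fun (x : dsum) : W := \sum_(i \in [set: I]) h i (x i).

Lemma dlift_funE (x : dsum) (s : seq I) : uniq s ->
  (forall i, i \notin s -> x i = 0) -> dlift_fun x = \sum_(i <- s) h i (x i).
Proof.
move=> us sx; rewrite /dlift_fun (fsbigE s) //=; last first.
  by move=> i _ /sx->; rewrite linear0.
by apply: eq_bigl => i; rewrite in_setT.
Qed.

Fact dlift_linear : linear dlift_fun.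
Proof.
move=> a x y; have [[s sx] [t ty]] := (dfin x, dfin y).
have us : uniq (undup (s ++ t)) by exact: undup_uniq.
have zx i : i \notin undup (s ++ t) -> x i = 0.
  by rewrite mem_undup mem_cat negb_or => /andP[/sx].
have zy i : i \notin undup (s ++ t) -> y i = 0.
  by rewrite mem_undup mem_cat negb_or => /andP[_ /ty].
rewrite (dlift_funE us zx) (dlift_funE us zy) (dlift_funE us) => [|i si].
  rewrite scaler_sumr -big_split; apply: eq_bigr => i _ /=.
  exact: linearP.
by rewrite dsumDE dsumZE zx // zy // scaler0 addr0.
Qed.
Definition dlift : {linear dsum -> W} := linear_pack dlift_linear.

Lemma dliftE i (a : A i) : dlift (dinj i a) = h i a.
Proof.
rewrite [LHS](@dlift_funE _ [:: i]) ?big_seq1 ?dinjE // => j.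
by rewrite inE eq_sym => ij; rewrite dinj_neq.
Qed.
End Lift.

Lemma dsum_projective : (forall i, projective (A i)) -> projective dsum.
Proof.
move=> pA U V g f gsurj.
have hE i : {h : {linear A i -> U} | forall a, g (h a) = f (dinj i a)}.
  apply: cid.
  have lf : linear (fun a => f (dinj i a)) by move=> c a b; rewrite !linearP.
  by have [h hE] := pA i U V g (linear_pack lf) gsurj; exists h.
exists (dlift (fun i => sval (hE i))); apply: dsum_ind => [|x y|i a].
- by rewrite !linear0.
- by rewrite !linearD => -> ->.
- by rewrite dliftE (svalP (hE i)).
Qed.
End DirectSum.
Arguments dproj {Q I A} i.
Arguments dinj {Q I A} i.

(** * Quasi-isomorphisms across a change of rings *)

Section Semilinear.
Variables (P Q Q' : comNzRingType) (u : {rmorphism P -> Q}) (u' : {rmorphism P -> Q'}).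

Definition semilinear (U : lmodType Q) (V : lmodType Q') (f : U -> V) : Prop :=
  forall p x y, f (u p *: x + y) = u' p *: f x + f y.

Variables (U : lmodType Q) (V : lmodType Q') (f : U -> V).
Hypothesis lf : semilinear f.

Lemma semilinearD x y : f (x + y) = f x + f y.
Proof. by have := lf 1 x y; rewrite !rmorph1 !scale1r. Qed.
Lemma semilinear0 : f 0 = 0.
Proof. by apply: (@addIr _ (f 0)); rewrite -semilinearD !add0r. Qed.
Lemma semilinearZ p x : f (u p *: x) = u' p *: f x.
Proof. by have := lf p x 0; rewrite semilinear0 !addr0. Qed.
Lemma semilinearN x : f (- x) = - f x.
Proof. by apply: (@addrI _ (f x)); rewrite -semilinearD !subrr semilinear0. Qed.
Lemma semilinearB x y : f (x - y) = f x - f y.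
Proof. by rewrite semilinearD semilinearN. Qed.
End Semilinear.

Lemma homology_ind (Q : comNzRingType) (C : complex Q) (T : homology C -> Prop) :
  (forall z : cycles C, T (\pi_(homology C) z)) -> forall h, T h.
Proof. by move=> Tz h; rewrite -[h]reprK. Qed.

Lemma cls_eq (Q : comNzRingType) (C : complex Q) (z w : cycles C) :
  \pi_(homology C) z = \pi_(homology C) w -> exists y, val z - val w = cd y.
Proof.
move=> zw; have [y yE] := cls_repr z; have [y' yE'] := cls_repr w.
exists (y' - y); rewrite [RHS]linearB -yE -yE' zw opprB [RHS]addrC.
by rewrite addrA subrK.
Qed.

(* The isomorphisms of graded P-modules, between modules that are given over
   P-algebras Q and Q'. *)
Definition piso (P Q Q' : comNzRingType) (u : {rmorphism P -> Q})
    (u' : {rmorphism P -> Q'}) (A : gmod Q) (B : gmod Q') : Prop :=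
  exists f : A -> B, [/\ bijective f, semilinear u u' f &
    forall i x, f (gpr i x) = gpr i (f x)].

Lemma piso_trans (P Q Q' Q'' : comNzRingType) (u : {rmorphism P -> Q})
    (u' : {rmorphism P -> Q'}) (u'' : {rmorphism P -> Q''})
    (A : gmod Q) (B : gmod Q') (C : gmod Q'') :
  piso u u' A B -> piso u' u'' B C -> piso u u'' A C.
Proof.
move=> [f [bf lf gf]] [g [bg lg gg]]; exists (g \o f); split.
- exact: bij_comp.
- by move=> p x y; rewrite /= lf lg.
- by move=> i x; rewrite /= gf gg.
Qed.

Lemma piso_sym (P Q Q' : comNzRingType) (u : {rmorphism P -> Q})
    (u' : {rmorphism P -> Q'}) (A : gmod Q) (B : gmod Q') :
  piso u u' A B -> piso u' u B A.
Proof.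
move=> [f [[g fK gK] lf gf]]; exists g; split; first by exists f.
- by move=> p x y; apply: (can_inj fK); rewrite lf !gK.
- by move=> i x; apply: (can_inj fK); rewrite gf !gK.
Qed.

Lemma piso_giso (P k : comNzRingType) (u : {rmorphism P -> k}) (A B : gmod k) :
  (forall c, exists a, u a = c) -> piso u u A B -> giso A B.
Proof.
move=> usurj [f [bf lf gf]].
have flin : linear f by move=> c x y; have [p <-] := usurj c; exact: lf.
by exists (linear_pack flin).
Qed.

Lemma piso_descent (P Q k : comNzRingType) (u : {rmorphism P -> Q})
    (phi : {rmorphism Q -> k}) (v : {rmorphism P -> k})
    (phi_surj : forall c, exists a, phi a = c) (A : gmod Q)
    (annA : annihilated phi A) : (forall p, v p = phi (u p)) ->
  piso u v A (descent_gmod phi_surj annA).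
Proof.
move=> vE; exists id; split=> //; first by exists id.
move=> p x y; rewrite vE; congr (_ + _).
exact/esym/descent_scaleE.
Qed.

Section QuasiIso.
Variables (P Q Q' : comNzRingType) (u : {rmorphism P -> Q}) (u' : {rmorphism P -> Q'}).
Variables (A : complex Q) (B : complex Q') (f : A -> B).
Hypothesis lf : semilinear u u' f.
Hypothesis f_cd : forall x, f (cd x) = cd (f x).

Fact cycle_image (z : cycles A) : f (val z) \in @Defs.cycle Q' B.
Proof.
have := cvalP z; rewrite !unfold_in -f_cd => /eqP->.
by rewrite (semilinear0 lf).
Qed.

Definition hmap (h : homology A) : homology B :=
  \pi_(homology B) (Cycle (cycle_image (repr h))).

Fact hmapE z : hmap (\pi_(homology A) z) =
  \pi_(homology B) (Cycle (cycle_image z)).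
Proof.
apply: clsP; have [y yE] := cls_repr z; exists (f y).
by rewrite /= -(semilinearB lf) -f_cd -yE.
Qed.

Lemma hmap_semilinear : semilinear u u' hmap.
Proof.
move=> p; elim/homology_ind => z; elim/homology_ind => w.
rewrite -clsZ -clsD !hmapE -clsZ -clsD; congr (\pi_(homology B) _).
by apply: val_inj; rewrite /= lf.
Qed.

(** Two degrees occur because the map that extracts the coefficient of y^(j) lowers degrees by
    2j. *)
Lemma hmap_deg i j : (forall x, f (gpr i x) = gpr j (f x)) ->
  forall h, hmap (hpr A i h) = hpr B j (hmap h).
Proof.
move=> f_deg; elim/homology_ind => z; rewrite /hpr /= hpr_funE !hmapE hpr_funE.
by congr (\pi_(homology B) _); apply: val_inj; rewrite /= f_deg.
Qed.

Hypothesis f_deg : forall i x, f (gpr i x) = gpr i (f x).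
Hypothesis f_inj : forall x, cd x = 0 -> (exists y, f x = cd y) ->
  exists y, x = cd y.
Hypothesis f_surj : forall y, cd y = 0 ->
  exists x y', cd x = 0 /\ y = f x + cd y'.

Lemma quasi_iso : piso u u' (homology_gmod A) (homology_gmod B).
Proof.
have lh := hmap_semilinear.
exists hmap; split=> // [|i h]; last exact: hmap_deg.
have hinj : injective hmap.
  move=> h l hl; apply/eqP; rewrite -subr_eq0; apply/eqP.
  have : hmap (h - l) = 0 by rewrite (semilinearB lh) hl subrr.
  elim/homology_ind: (h - l) => z; rewrite hmapE => z0.
  have [||y yE] := @f_inj (val z); first by apply/eqP; exact: cvalP z.
    have [|y yE] := @cls_eq _ B (Cycle (cycle_image z)) 0.
      by rewrite z0 raddf0.
    exists y; by rewrite -yE !raddf0 addr0.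
  rewrite -(raddf0 (\pi_(homology A))); apply: clsP.
  by exists y; rewrite !raddf0 addr0.
have hsurj l : exists h, hmap h = l.
  elim/homology_ind: l => z.
  have [|x [y [cx zE]]] := @f_surj (val z); first by apply/eqP; exact: cvalP z.
  have cxP : x \in @Defs.cycle Q A by rewrite unfold_in cx.
  exists (\pi_(homology A) (Cycle cxP)); rewrite hmapE; apply: clsP.
  by exists (- y); rewrite /= zE linearN opprD addNKr.
exists (fun l => sval (cid (hsurj l))) => [h|l]; last exact: svalP (cid (hsurj l)).
by apply: hinj; exact: svalP (cid (hsurj (hmap h))).
Qed.
End QuasiIso.

Section ChainIso.
Variables (P Q Q' : comNzRingType) (u : {rmorphism P -> Q}) (u' : {rmorphism P -> Q'}).
Variables (A : complex Q) (B : complex Q') (f : A -> B).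
Hypothesis lf : semilinear u u' f.
Hypothesis f_deg : forall i x, f (gpr i x) = gpr i (f x).
Hypothesis f_cd : forall x, f (cd x) = cd (f x).
Hypothesis f_bij : bijective f.

Lemma chain_iso : piso u u' (homology_gmod A) (homology_gmod B).
Proof.
have [g fK gK] := f_bij; apply: (quasi_iso lf f_cd f_deg) => [x _ [y fx]|y cy].
  by exists (g y); apply: (can_inj fK); rewrite f_cd gK.
exists (g y), 0; rewrite linear0 addr0 gK; split=> //; apply: (can_inj fK).
by rewrite f_cd gK cy (semilinear0 lf).
Qed.
End ChainIso.

(** * Comparison of resolutions *)

Section ResolutionLift.
Variables (Q : comNzRingType) (L : lmodType Q).

Lemma cd_gpr_0 (Y : proj_resolution L) (y : Y) : cd (gpr 0 y) = 0.
Proof. by rewrite cd_deg r_neg. Qed.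

Lemma raug_gpr_0 (Y : proj_resolution L) (y : Y) : raug Y (gpr 0 y) = raug Y y.
Proof.
move: y; apply: homog_ind => [|x y xE yE|i x xi]; first by rewrite !linear0.
  by rewrite !linearD xE yE.
rewrite (gpr_homog _ xi); case: eqP => // /eqP; rewrite eq_sym => i0.
by rewrite linear0 -xi raug_deg.
Qed.

(** The augmentation only sees degree 0, where the differential vanishes; so the degree 0 component
    of a preimage can be exchanged for one with the prescribed augmentation. *)
Lemma aug_boundary (Y : proj_resolution L) (z : Y) (l : L) :
  cd z = 0 -> raug Y z = 0 -> exists y, cd y = z /\ raug Y y = l.
Proof.
move=> cz az; have [y ->] := r_exact cz az; have [x <-] := raug_surj Y l.
exists (y - gpr 0 y + gpr 0 x); split.
  by rewrite linearD linearB /= !cd_gpr_0 subr0 addr0.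
by rewrite linearD linearB /= !raug_gpr_0 subrr add0r.
Qed.

Variables (X Y : proj_resolution L) (w : {linear X -> Y}) (al : {linear X -> L}).
Variables (c : Q) (r : int).
Hypothesis w_cd : forall x, cd (w x) + c *: w (cd x) = 0.
Hypothesis w_aug : forall x, raug Y (w x) + c *: al (cd x) = 0.
Hypothesis w_deg : forall i x, gpr i x = x -> gpr (i + r - 1) (w x) = w x.
Hypothesis al_deg : forall i x, gpr i x = x -> i + r != 0 -> al x = 0.

Let solves (t : X -> Y) (x : X) (y : Y) :=
  cd (t x) = y /\ raug Y (t x) = al x.
(** The equation d t = w + c t d restricted to d(X_n), where the last term vanishes because d
    squares to zero. This is what the next map needs in order to be defined on X_n. *)
Let valid (n : nat) (t : X -> Y) :=
  forall x, solves t (cd (gpr n%:Z x)) (w (cd (gpr n%:Z x))).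
Let extends (n : nat) (t t' : X -> Y) := forall x,
  solves t' (gpr n%:Z x) (w (gpr n%:Z x) + c *: t (cd (gpr n%:Z x))).

Fact resolution_lift_step n (t : {linear X -> Y}) : valid n t ->
  exists t' : {linear X -> Y}, valid n.+1 t' /\ extends n t t'.
Proof.
move=> tv.
(* One lift through the pair (d, augmentation) treats degree 0 and the positive degrees together. *)
have d_lin : linear (fun y : Y => (cd y, raug Y y) : (Y * L)%type).
  by move=> a x y; rewrite !linearP.
have v_lin : linear (fun x : X =>
    (w (gpr n%:Z x) + c *: t (cd (gpr n%:Z x)), al (gpr n%:Z x)) : (Y * L)%type).
  move=> a x y; rewrite !linearP; congr (_, _).
  by rewrite /= !scalerDr !scalerA (mulrC a) addrACA.
have [|h hE] := projective_lift (g := linear_pack d_lin) (f := linear_pack v_lin) (r_proj X).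
  move=> x /=; have [tc ta] := tv x; set x' := gpr n%:Z x in tc ta *.
  have [||y [yc ya]] := @aug_boundary Y (w x' + c *: t (cd x')) (al x').
  - by rewrite linearD linearZ /= tc w_cd.
  - by rewrite linearD linearZ /= ta w_aug.
  - by exists y; rewrite yc ya.
exists h; split=> x; last first.
  by have [hc ha] := hE (gpr n%:Z x); split; rewrite ?hc ?ha gprK eqxx.
have -> : cd (gpr n.+1%:Z x) = gpr n%:Z (cd x).
  by rewrite cd_deg -addn1 PoszD addrK.
have [hc ha] := hE (gpr n%:Z (cd x)); rewrite /solves hc ha gprK eqxx.
by rewrite cd_deg cdd !linear0 ?scaler0 addr0.
Qed.

(** One recursion for two purposes: with c = 1, w = 0 and the augmentation as [al] it gives
    comparison maps; with c = -1 and [al] = 0, [s] is a null-homotopy of [w]. *)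
Lemma resolution_lift : exists s : {linear X -> Y},
  (forall i x, gpr i x = x -> gpr (i + r) (s x) = s x) /\
  forall x, cd (s x) = w x + c *: s (cd x) /\ raug Y (s x) = al x.
Proof.
have z_lin : linear (fun _ : X => 0 : Y) by move=> a x y; rewrite scaler0 addr0.
have z0 : valid 0 (linear_pack z_lin).
  by move=> x; rewrite cd_gpr_0 /solves !linear0.
pose T n := {t : {linear X -> Y} | valid n t}.
have nxt n (t : T n) : {t' : T n.+1 | extends n (sval t) (sval t')}.
  case: t => t /= /resolution_lift_step/cid[t' [t'1 t'2]].
  by exists (exist _ t' t'1).
pose ts n : T n := nat_rect T (exist _ (linear_pack z_lin) z0) (fun m t => sval (nxt m t)) n.
have tsE n : extends n (sval (ts n)) (sval (ts n.+1)) := svalP (nxt n (ts n)).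
(* Stage n + 1 is the one that solves the equation in degree n. The lifts given by projectivity need
   not be homogeneous, so they are projected to degree i + r. *)
pose G (i : int) (x : X) : Y :=
  if i is Posz n then gpr (i + r) (sval (ts n.+1) x) else 0.
have Glin i : linear (G i).
  by move=> a x y; case: i => n /=; rewrite ?linearP // scaler0 addr0.
pose s := linear_pack (hsum_linear Glin).
have sE i x : gpr i x = x -> s x = G i x by move=> xi; exact: hsum_homog.
exists s; split=> [i x xi|].
  rewrite (sE _ _ xi); case: i {xi} => n; last by rewrite /= linear0.
  by rewrite /G gprK eqxx.
apply: homog_ind => [|x y [xc xa] [yc ya]|i x xi].
- by rewrite !linear0 ?scaler0 addr0.
- rewrite !linearD xc yc xa ya; split=> //.
  by rewrite -!scalerDr ?scalerDr addrACA.
case: i xi => [n|n] xi; last by rewrite -xi r_neg // !linear0 ?scaler0 addr0.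
rewrite (sE _ _ xi) /G; have [hc ha] := tsE n x; rewrite xi in hc ha.
split.
  rewrite cd_deg hc linearD /= (w_deg xi) linearZ /=; congr (_ + c *: _).
  rewrite -[RHS]/(s (cd x)) (sE _ _ (cd_homog xi)) /G; case: n xi {hc ha} => [|n] xi.
    by rewrite -xi cd_gpr_0 !linear0.
  have -> : n.+1%:Z - 1 = n%:Z by rewrite -addn1 PoszD addrK.
  by congr (gpr _ _); rewrite -addn1 PoszD addrAC addrK.
have [nr|nr] := eqVneq (n%:Z + r) 0; first by rewrite nr raug_gpr_0.
by rewrite raug_deg // (al_deg xi nr).
Qed.
End ResolutionLift.

(** * Tensor products of maps and homotopies with a complex *)

Section TensorMap.
Variables (Q : comNzRingType) (A A' B : gmod Q) (s : {linear A -> A'}).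

Fact tmap_bilin : bilin (fun x y => tens (s x) y : tensor A' B).
Proof.
split=> [y a x x'|x a y y']; first by rewrite linearP tensDl tensZl.
by rewrite tensDr tensZr.
Qed.
Definition tmap : {linear tensor A B -> tensor A' B} := tlift tmap_bilin.

Lemma tmapE x y : tmap (tens x y) = tens (s x) y.
Proof. exact: tliftE. Qed.

Lemma tmap_deg r : (forall i x, gpr i x = x -> gpr (i + r) (s x) = s x) ->
  forall n t, tmap (tpr A B n t) = tpr A' B (n + r) (tmap t).
Proof.
move=> sdeg n; apply: tensor_ind => [|t t' tE tE'|i j x y xi yj].
- by rewrite !linear0.
- by rewrite !linearD tE tE'.
rewrite (tprE _ xi yj) !tmapE (tprE _ (sdeg _ _ xi) yj) addrAC.
by rewrite (inj_eq (addIr _)); case: eqP; rewrite ?tmapE // linear0.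
Qed.
End TensorMap.

Lemma signz_succ (R : pzRingType) (i : int) :
  (-1) ^+ absz (i + 1) = - (-1) ^+ absz i :> R.
Proof.
case: i => [n|[|n]]; first by rewrite -PoszD addn1 !absz_nat exprS mulN1r.
  by rewrite NegzE addNr /= expr0 expr1 opprK.
have -> : Negz n.+1 + 1 = - n.+1%:Z.
  by rewrite NegzE -[n.+2]addn1 PoszD opprD addrNK.
by rewrite NegzE !abszN !absz_nat [in RHS]exprS mulN1r opprK.
Qed.

Section GsignMap.
Variables (Q : comNzRingType) (A A' : complex Q) (s : {linear A -> A'}).

Lemma gsign_even : (forall i x, gpr i x = x -> gpr i (s x) = s x) ->
  forall x, gsign (s x) = s (gsign x).
Proof.
move=> sdeg; apply: homog_ind => [|x y xE yE|i x xi].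
- by rewrite !linear0.
- by rewrite [s (x + y)]linearD [gsign (s x + s y)]linearD /= xE yE [gsign (x + y)]linearD
    [RHS]linearD.
by rewrite (gsignE (sdeg _ _ xi)) (gsignE xi) [RHS]linearZ.
Qed.

Lemma gsign_odd : (forall i x, gpr i x = x -> gpr (i + 1) (s x) = s x) ->
  forall x, gsign (s x) = - s (gsign x).
Proof.
move=> sdeg; apply: homog_ind => [|x y xE yE|i x xi].
- by rewrite !linear0 ?oppr0.
- by rewrite [s (x + y)]linearD [gsign (s x + s y)]linearD /= xE yE [gsign (x + y)]linearD
    [s (_ + _)]linearD opprD.
by rewrite (gsignE (sdeg _ _ xi)) (gsignE xi) [s (_ *: _)]linearZ signz_succ scaleNr.
Qed.
End GsignMap.

Section TensorHomotopy.
Variables (Q : comNzRingType) (A A' B : complex Q).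

Lemma tmap_chain (u : {linear A -> A'}) :
  (forall x, gsign (u x) = u (gsign x)) ->
  (forall x, cd (u x) = u (cd x)) ->
  forall t, td A' B (tmap B u t) = tmap B u (td A B t).
Proof.
move=> usign ucd; apply: tensor_ind => [|t t' tE tE'|i j x y _ _].
- by rewrite !linear0.
- by rewrite !linearD tE tE'.
by rewrite tmapE !tdE linearD /= !tmapE ucd usign.
Qed.

(** Being of degree 1, [s] anticommutes with the sign in the tensor differential, so the two terms
    that contain the differential of [B] cancel. *)
Lemma tmap_homotopy (s w : {linear A -> A'}) :
  (forall i x, gpr i x = x -> gpr (i + 1) (s x) = s x) ->
  (forall x, cd (s x) + s (cd x) = w x) ->
  forall t, td A' B (tmap B s t) + tmap B s (td A B t) = tmap B w t.
Proof.
move=> sdeg sE; apply: tensor_ind => [|t t' tE tE'|i j x y _ _].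
- by rewrite !linear0 addr0.
- rewrite [td A B (t + t')]linearD [tmap B s (t + t')]linearD.
  rewrite [td A' B (_ + _)]linearD [tmap B s (_ + _)]linearD [RHS]linearD /=.
  by rewrite -tE -tE' addrACA.
rewrite !tmapE !tdE linearD /= !tmapE gsign_odd // addrACA -!tensDl sE.
by rewrite addNr tens0l addr0.
Qed.
End TensorHomotopy.

(** * Uniqueness of resolutions up to homotopy *)

Section Comparison.
Variables (Q : comNzRingType) (L : lmodType Q).

Lemma comparison_map (X Y : proj_resolution L) : exists u : {linear X -> Y},
  [/\ forall i x, gpr i x = x -> gpr i (u x) = u x,
      forall x, cd (u x) = u (cd x) & forall x, raug Y (u x) = raug X x].
Proof.
have z_lin : linear (fun _ : X => 0 : Y) by move=> a x y; rewrite scaler0 addr0.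
have [||||u [udeg uE]] :=
    @resolution_lift _ _ X Y (linear_pack z_lin) (raug X) 1 0.
- by move=> x; rewrite linear0 scaler0 addr0.
- by move=> x; rewrite linear0 scale1r raug_cd addr0.
- by move=> i x _; rewrite linear0.
- by move=> i x xi; rewrite addr0 => i0; rewrite -xi raug_deg.
exists u; split=> [i x /udeg|x|x]; first by rewrite addr0.
- by have [-> _] := uE x; rewrite scale1r add0r.
- by have [_] := uE x.
Qed.

Lemma comparison_homotopy (X Y : proj_resolution L) (u v : {linear X -> Y}) :
  (forall i x, gpr i x = x -> gpr i (u x) = u x) ->
  (forall i x, gpr i x = x -> gpr i (v x) = v x) ->
  (forall x, cd (u x) = u (cd x)) -> (forall x, cd (v x) = v (cd x)) ->
  (forall x, raug Y (u x) = raug Y (v x)) ->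
  exists s : {linear X -> Y},
    (forall i x, gpr i x = x -> gpr (i + 1) (s x) = s x) /\
    forall x, cd (s x) + s (cd x) = u x - v x.
Proof.
move=> udeg vdeg ucd vcd uva.
have w_lin : linear (fun x => u x - v x).
  by move=> a x y; rewrite [u _]linearP [v _]linearP scalerBr opprD addrACA.
have z_lin : linear (fun _ : X => 0 : L) by move=> a x y; rewrite scaler0 addr0.
have [||||s [sdeg sE]] :=
    @resolution_lift _ _ X Y (linear_pack w_lin) (linear_pack z_lin) (-1) 1.
- by move=> x; rewrite /= linearB /= ucd vcd scaleN1r subrr.
- by move=> x; rewrite /= linearB /= uva subrr scaler0 addr0.
- by move=> i x xi; rewrite addrK linearB /= udeg // vdeg.
- by [].
exists s; split=> // x; have [-> _] := sE x.
by rewrite scaleN1r addrNK.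
Qed.

(** Tor is formed from whichever resolution is supplied; this lets an explicit one take its place.
    Comparison maps in both directions are inverse up to homotopy, and the homotopies survive
    tensoring. *)
Lemma resolution_independence (P : comNzRingType) (p : {rmorphism P -> Q})
    (X Y : proj_resolution L) (M : complex Q) :
  piso p p (homology_gmod (tensor_complex X M)) (homology_gmod (tensor_complex Y M)).
Proof.
have [u [udeg ucd ua]] := comparison_map X Y.
have [v [vdeg vcd va]] := comparison_map Y X.
have id_lin (Z : lmodType Q) : linear (@id Z) by [].
have inv_htpy (Z Z' : proj_resolution L) (f : {linear Z -> Z'}) (g : {linear Z' -> Z}) :
    (forall i x, gpr i x = x -> gpr i (f x) = f x) ->
    (forall i x, gpr i x = x -> gpr i (g x) = g x) ->
    (forall x, cd (f x) = f (cd x)) -> (forall x, cd (g x) = g (cd x)) ->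
    (forall x, raug Z' (f x) = raug Z x) -> (forall x, raug Z (g x) = raug Z' x) ->
    exists s : {linear tensor Z M -> tensor Z M}, forall t,
      td Z M (s t) + s (td Z M t) = t - tmap M g (tmap M f t).
  move=> fdeg gdeg fcd gcd fa ga.
  have gf_lin : linear (g \o f) by move=> a x y; rewrite /= !linearP.
  have [|||||s [sdeg sE]] := @comparison_homotopy Z Z (linear_pack (id_lin _)) (linear_pack gf_lin).
  - by [].
  - by move=> i x xi /=; rewrite gdeg // fdeg.
  - by [].
  - by move=> x /=; rewrite gcd fcd.
  - by move=> x /=; rewrite ga fa.
  have w_lin : linear (fun x => x - g (f x)).
    by move=> a x y; rewrite [f _]linearP [g _]linearP scalerBr opprD addrACA.
  exists (tmap M s) => t; rewrite (tmap_homotopy (w := linear_pack w_lin) sdeg sE).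
  move: t; apply: tensor_ind => [|t t' tE tE'|i j x y _ _].
  - by rewrite !linear0 ?addr0 ?subr0.
  - rewrite [tmap M (linear_pack w_lin) _]linearD [tmap M f _]linearD.
    by rewrite [tmap M g _]linearD tE tE' opprD addrACA.
  by rewrite !tmapE /= -scaleN1r tensDl tensZl scaleN1r.
have [s sE] := inv_htpy _ _ u v udeg vdeg ucd vcd ua va.
have [s' sE'] := inv_htpy _ _ v u vdeg udeg vcd ucd va ua.
have chain_u := tmap_chain (B := M) (gsign_even udeg) ucd.
have chain_v := tmap_chain (B := M) (gsign_even vdeg) vcd.
apply: (@quasi_iso _ _ _ _ _ (tensor_complex X M) (tensor_complex Y M) (tmap M u)).
- by move=> a x y; rewrite linearP.
- by move=> x; rewrite [RHS]chain_u.
- have udeg0 i x : gpr i x = x -> gpr (i + 0) (u x) = u x by rewrite addr0; exact: udeg.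
  by move=> i x; rewrite (tmap_deg udeg0) addr0.
- move=> x cx [y uy]; exists (s x + tmap M v y).
  have := sE x; have -> : td X M x = 0 by exact: cx.
  rewrite linear0 addr0 uy [cd y]/(td Y M y) -chain_v => /eqP.
  by rewrite eq_sym subr_eq => /eqP xE; rewrite [RHS]linearD.
- move=> y cy; exists (tmap M v y), (s' y).
  have cy0 : td Y M y = 0 by exact: cy.
  split; first by rewrite [LHS]chain_v cy0 linear0.
  have := sE' y; rewrite cy0 linear0 addr0 => yE.
  by rewrite [cd _]yE addrC subrK.
Qed.
End Comparison.

(** * Systems of higher homotopies *)

(** Both sides run over i + j + k = n: this is the rearrangement behind associativity of the product
    of power series. *)
Lemma sum_triangle (V : nmodType) (n : nat) (H : nat -> nat -> nat -> V) :
  \sum_(i < n.+1) \sum_(j < (n - i).+1) H i j (n - i - j)%N =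
  \sum_(i < n.+1) \sum_(j < i.+1) H j (i - j)%N (n - i)%N.
Proof.
transitivity (\sum_(i < n.+1) \sum_(j < n.+1 | (j <= i)%N) H j (i - j)%N (n - i)%N).
  rewrite (exchange_big_dep xpredT) //=; apply: eq_bigr => -[j /= jn] _.
  rewrite -(big_mkord xpredT (fun k => H j k (n - j - k)%N)).
  rewrite -(big_geq_mkord j n.+1 xpredT (fun i => H j (i - j)%N (n - i)%N)).
  have := big_addn 0 n.+1 j xpredT (fun i => H j (i - j)%N (n - i)%N).
  rewrite add0n => ->; rewrite subSn //; apply: eq_bigr => k _.
  by rewrite addnK addnC subnDA.
apply: eq_bigr => i _.
by rewrite [RHS](big_ord_widen_cond n.+1 xpredT (fun j => H j (i - j)%N (n - i)%N)).
Qed.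

Lemma sum_triangleC (V : nmodType) (n : nat) (H : nat -> nat -> nat -> V) :
  \sum_(i < n.+1) \sum_(j < (n - i).+1) H i j (n - i - j)%N =
  \sum_(j < n.+1) \sum_(i < (n - j).+1) H i j (n - j - i)%N.
Proof.
rewrite sum_triangle (sum_triangle n (fun j i k => H i j k)).
apply: eq_bigr => i _; rewrite (reindex_inj rev_ord_inj) /=.
by apply: eq_bigr => j _; rewrite subSS subKn // -ltnS.
Qed.

(** The analogue in two variables, for the cube of the two-parameter operator. *)
Lemma sum_triangle2 (V : nmodType) (m n : nat)
    (H : nat -> nat -> nat -> nat -> nat -> nat -> V) :
  \sum_(k : 'I_m.+1 * 'I_n.+1) \sum_(l : 'I_(m - k.1).+1 * 'I_(n - k.2).+1)
     H k.1 l.1 (m - k.1 - l.1)%N k.2 l.2 (n - k.2 - l.2)%N =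
  \sum_(k : 'I_m.+1 * 'I_n.+1) \sum_(l : 'I_k.1.+1 * 'I_k.2.+1)
     H l.1 (k.1 - l.1)%N (m - k.1)%N l.2 (k.2 - l.2)%N (n - k.2)%N.
Proof.
pose K a b c := \sum_(i < n.+1) \sum_(j < (n - i).+1) H a b c i j (n - i - j)%N.
transitivity (\sum_(i < m.+1) \sum_(j < (m - i).+1) K i j (m - i - j)%N).
  rewrite -(pair_bigA _ (fun (i : 'I_m.+1) (i' : 'I_n.+1) =>
    \sum_(l : 'I_(m - i).+1 * 'I_(n - i').+1)
       H i l.1 (m - i - l.1)%N i' l.2 (n - i' - l.2)%N)) /=.
  apply: eq_bigr => i _; rewrite exchange_big; apply: eq_bigr => i' _ /=.
  by rewrite -(pair_bigA _ (fun (j : 'I_(m - i).+1) (j' : 'I_(n - i').+1) =>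
    H i j (m - i - j)%N i' j' (n - i' - j')%N)).
rewrite (sum_triangle m K).
rewrite -(pair_bigA _ (fun (i : 'I_m.+1) (i' : 'I_n.+1) =>
  \sum_(l : 'I_i.+1 * 'I_i'.+1)
     H l.1 (i - l.1)%N (m - i)%N l.2 (i' - l.2)%N (n - i')%N)) /=.
apply: eq_bigr => i _; under eq_bigr => j _ do rewrite /K (sum_triangle n (H _ _ _)).
rewrite exchange_big; apply: eq_bigr => i' _ /=.
by rewrite -(pair_bigA _ (fun (j : 'I_i.+1) (j' : 'I_i'.+1) =>
  H j (i - j)%N (m - i)%N j' (i' - j')%N (n - i')%N)).
Qed.

Section HigherHomotopies.
Variables (P : comNzRingType) (L : lmodType P) (G : proj_resolution L).

Definition homogeneous (r : int) (s : G -> G) : Prop :=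
  forall i x, gpr i x = x -> gpr (i + r) (s x) = s x.

Lemma null_homotopy (r : nat) (w : G -> G) : linear w -> homogeneous r%:Z w ->
  (forall x, cd (w x) = w (cd x)) -> (forall x, raug G (w x) = 0) ->
  exists s, [/\ linear s, homogeneous (r%:Z + 1) s &
    forall x, cd (s x) + s (cd x) = w x].
Proof.
move=> wlin wdeg wcd wa.
have z_lin : linear (fun _ : G => 0 : L) by move=> a x y; rewrite scaler0 addr0.
have [||||s [sdeg sE]] :=
    @resolution_lift _ _ G G (linear_pack wlin) (linear_pack z_lin) (-1) (r%:Z + 1).
- by move=> x; rewrite /= wcd scaleN1r subrr.
- by move=> x; rewrite /= wa scaler0 addr0.
- by move=> i x xi; rewrite addrA addrK /= wdeg.
- by [].
exists s; split=> // [|x]; first exact: linearP.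
by have [-> _] := sE x; rewrite scaleN1r addrNK.
Qed.

(* The operator sum_i s_i t^i on G<y>, where t is the contraction of degree -2,
   squares to f t. *)
Record homotopy_system (f : P) (s : nat -> G -> G) : Prop := {
  hs_linear : forall i, linear (s i);
  hs_homog : forall i, homogeneous (i.*2%:Z - 1) (s i);
  hs_0 : forall x, s 0%N x = cd x;
  hs_sqr : forall n x, \sum_(i < n.+1) s i (s (n - i)%N x) =
    if n == 1%N then f *: x else 0
}.

Lemma trivial_system : homotopy_system 0 (fun i x => if i is 0 then cd x else 0).
Proof.
split=> // [[|i]|[|i]|n x].
- exact: linearP.
- by move=> a x y; rewrite scaler0 addr0.
- by move=> j x xj; rewrite add0r cd_homog.
- by move=> j x xj; rewrite linear0.
rewrite scale0r if_same big1 // => -[[|i] /= _] _ //.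
by rewrite subn0; case: n => [|n]; rewrite ?cdd ?linear0.
Qed.

Section Extension.
Variables (f a : P) (s : nat -> G -> G).
Hypothesis fs : homotopy_system f s.
Hypothesis aL : forall y : L, a *: y = 0.

(** The coefficient of t^i T^j in f t + a T; [conv2] is that of the square of the operator. *)
Let coef (i j : nat) : P :=
  if (i, j) == (1, 0)%N then f else if (i, j) == (0, 1)%N then a else 0.

Definition conv2 (T : nat -> nat -> G -> G) (i j : nat) (x : G) : G :=
  \sum_(k : 'I_i.+1 * 'I_j.+1) T k.1 k.2 (T (i - k.1)%N (j - k.2)%N x).

(* [T i j] is the coefficient of t^i T^j in the two-parameter operator; it is
   fixed up to total degree N, and still zero beyond it unless j = 0. *)
Record partial_extension (N : nat) (T : nat -> nat -> G -> G) : Prop := {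
  pe_linear : forall i j, linear (T i j);
  pe_homog : forall i j, homogeneous ((i + j).*2%:Z - 1) (T i j);
  pe_0 : forall i, T i 0%N = s i;
  pe_out : forall i j, (N < i + j)%N -> (0 < j)%N -> forall x, T i j x = 0;
  pe_sqr : forall i j, (i + j <= N)%N -> forall x, conv2 T i j x = coef i j *: x
}.

(** The monomials free of T involve [s] alone, so their equations hold in every degree from the
    start. *)
Lemma conv2_0r T i x : (forall i, T i 0%N = s i) -> conv2 T i 0 x = coef i 0 *: x.
Proof.
move=> T0; rewrite /conv2.
rewrite -(pair_bigA _ (fun (k : 'I_i.+1) (l : 'I_1) =>
  T k l (T (i - k)%N (0 - l)%N x))) /=.
under eq_bigr => k _ do rewrite big_ord1 !T0.
rewrite (hs_sqr fs) /coef; case: i => [|[|i]] /=; rewrite ?scale0r //.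
Qed.

Section Step.
Variables (N : nat) (T : nat -> nat -> G -> G).
Hypothesis TN : partial_extension N T.

Let Tlin i j := linear_pack (pe_linear TN i j).

Lemma conv2_linear i j : linear (conv2 T i j).
Proof.
move=> c x y; rewrite /conv2 scaler_sumr -big_split; apply: eq_bigr => k _ /=.
by rewrite (pe_linear TN) (pe_linear TN).
Qed.

Lemma conv2_homog i j : homogeneous ((i + j).*2%:Z - 2) (conv2 T i j).
Proof.
move=> m x xm; rewrite /conv2 linear_sum; apply: eq_bigr => -[k l] _ /=.
have H : gpr (m + (i + j).*2%:Z - 2) (T k l (T (i - k)%N (j - l)%N x)) =
    T k l (T (i - k)%N (j - l)%N x).
  have Txm := @pe_homog _ _ TN (i - k)%N (j - l)%N _ _ xm.
  have := @pe_homog _ _ TN k l _ _ Txm.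
  by congr (gpr _ _ = _); have := ltn_ord k; have := ltn_ord l; lia.
by rewrite addrA.
Qed.

Definition defect i j x := coef i j *: x - conv2 T i j x.

Lemma defect_linear i j : linear (defect i j).
Proof.
move=> b y z; rewrite /defect conv2_linear scalerDr opprD addrACA.
by rewrite scalerBr !scalerA (mulrC b).
Qed.

Lemma defect0 i j y : (i + j <= N)%N -> defect i j y = 0.
Proof. by move=> ijN; rewrite /defect (pe_sqr TN) // subrr. Qed.

Let rev_pair i j (k : 'I_i.+1 * 'I_j.+1) := (rev_ord k.1, rev_ord k.2).

Fact rev_pairK i j : involutive (@rev_pair i j).
Proof. by move=> [k l]; rewrite /rev_pair /= !rev_ordK. Qed.

(** The operator D commutes with f t + a T, whose coefficients are scalars, and with its own
    square. *)
Lemma defect_assoc i j x :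
  \sum_(k : 'I_i.+1 * 'I_j.+1) T k.1 k.2 (defect (i - k.1) (j - k.2) x) =
  \sum_(k : 'I_i.+1 * 'I_j.+1) defect k.1 k.2 (T (i - k.1)%N (j - k.2)%N x).
Proof.
have Tl i' j' y z : T i' j' (y - z) = T i' j' y - T i' j' z.
  exact: (linearB (Tlin i' j')).
rewrite /defect; under eq_bigr => k _ do rewrite Tl.
rewrite !sumrB; congr (_ - _).
  rewrite (reindex_inj (inv_inj (@rev_pairK i j))); apply: eq_bigr => -[k l] _ /=.
  rewrite [LHS](linearZ_LR (Tlin _ _)) /= !subSS.
  by rewrite !subKn // -ltnS.
have H := sum_triangle2 i j (fun a b c a' b' c' => T a a' (T b b' (T c c' x))).
rewrite /conv2; etransitivity; last by rewrite -H.
by apply: eq_bigr => k _; rewrite [LHS](linear_sum (Tlin _ _)).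
Qed.

(* The identity D (f t + a T - D^2) = (f t + a T - D^2) D, compared at a lowest
   coefficient of f t + a T - D^2 that may be nonzero. *)
Lemma defect_comm i j x : (i + j)%N = N.+1 -> cd (defect i j x) = defect i j (cd x).
Proof.
move=> ijN; have := defect_assoc i j x.
have T00 y : T 0%N 0%N y = cd y by rewrite (pe_0 TN) (hs_0 fs).
rewrite (bigD1 (ord0, ord0)) //= T00 !subn0 big1 => [|[k l] /= kl]; last first.
  rewrite defect0; first exact: (linear0 (Tlin _ _)).
  rewrite -ltnS -ijN; have := ltn_ord k; have := ltn_ord l.
  have : (0 < k + l)%N.
    by apply: contraR kl; rewrite -leqNgt leqn0 addn_eq0 xpair_eqE.
  by lia.
rewrite [in RHS](bigD1 (ord_max, ord_max)) //= !subnn T00 !addr0.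
rewrite big1 ?addr0 // => -[k l] /= kl; apply: defect0.
rewrite -ltnS -ijN; have := ltn_ord k; have := ltn_ord l.
have : ~~ ((k == i :> nat) && (l == j :> nat)).
  by apply: contra kl => /andP[ki lj]; rewrite xpair_eqE -!val_eqE /= ki.
by lia.
Qed.
(** Apart from the differential, these operators have degree at least 1, so their values lie in
    positive degrees, where the augmentation vanishes. *)
Lemma raug_pe i j y : raug G (T i j y) = 0.
Proof.
have [/eqP|ij] := eqVneq (i + j)%N 0%N.
  rewrite addn_eq0 => /andP[/eqP-> /eqP->].
  by rewrite (pe_0 TN) (hs_0 fs) raug_cd.
have T0 : T i j 0 = 0 := linear0 (Tlin i j).
have TD y' z' : T i j (y' + z') = T i j y' + T i j z' := linearD (Tlin i j) y' z'.
move: y; apply: homog_ind => [|y z|m y ym].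
- by rewrite T0 linear0.
- by rewrite TD linearD => -> ->; rewrite addr0.
case: m ym => [m|m] ym; last by rewrite -ym r_neg // T0 linear0.
rewrite -(@pe_homog _ _ TN i j _ _ ym) raug_deg //; lia.
Qed.

(** In total degree N + 1 the defect is a chain map of even degree 2N. As j > 0, its scalar part is
    [a] or 0, which kills [L], so the defect is null-homotopic; the homotopy is the missing
    operator. *)
Lemma extension_operator i j : (i + j)%N = N.+1 -> (0 < j)%N ->
  exists s, [/\ linear s, homogeneous ((i + j).*2%:Z - 1) s &
    forall x, cd (s x) + s (cd x) = defect i j x].
Proof.
move=> ijN j0.
have coefE : coef i j = if (i, j) == (0, 1)%N then a else 0.
  by rewrite /coef; case: ifP => // /eqP[_ j1]; rewrite j1 in j0.
have -> : (i + j).*2%:Z - 1 = N.*2%:Z + 1 by lia.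
apply: null_homotopy.
- exact: defect_linear.
- move=> m x xm; rewrite /defect linearB.
  have := conv2_homog i j xm.
  have -> : m + ((i + j).*2%:Z - 2) = m + N.*2%:Z by lia.
  move=> ->; congr (_ - _); rewrite linearZ coefE /=.
  case: eqP => [[i0 j1]|_]; last by rewrite !scale0r.
  by have -> : N = 0%N; [lia | rewrite addr0 xm].
- by move=> x; exact: defect_comm.
move=> x; rewrite /defect linearB [raug G (conv2 _ _ _ _)]linear_sum big1.
  by rewrite subr0 linearZ coefE /=; case: eqP => _; rewrite ?aL // scale0r.
by move=> k _; exact: raug_pe.
Qed.

Lemma extension_step : exists T',
  partial_extension N.+1 T' /\ forall i j, (i + j <= N)%N -> T' i j = T i j.
Proof.
pose top i j := ((i + j)%N == N.+1) && (0 < j)%N.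
have sE i j : {s | top i j ->
    [/\ linear s, homogeneous ((i + j).*2%:Z - 1) s &
    forall x, cd (s x) + s (cd x) = defect i j x]}.
  apply: cid; case E : (top i j); last by exists id.
  have /andP[/eqP ijN j0] := E.
  by have [s' s'E] := extension_operator ijN j0; exists s'.
have [S SE] : exists S : nat -> nat -> G -> G, forall i j, top i j ->
    [/\ linear (S i j), homogeneous ((i + j).*2%:Z - 1) (S i j) &
    forall x, cd (S i j x) + S i j (cd x) = defect i j x].
  by exists (fun i j => sval (sE i j)) => i j; exact: svalP (sE i j).
pose T' i j := if top i j then S i j else T i j.
have T'T i j : (i + j <= N)%N -> T' i j = T i j.
  by move=> ijN; rewrite /T' /top ltn_eqF.
exists T'; split=> //; split.
- move=> i j; rewrite /T'; case: ifP => [/SE[]//|_].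
  exact: pe_linear TN i j.
- move=> i j; rewrite /T'; case: ifP => [/SE[]//|_].
  exact: pe_homog TN i j.
- by move=> i; rewrite /T' /top andbF (pe_0 TN).
- move=> i j ijN j0 x; rewrite /T' /top gtn_eqF //=.
  by rewrite (pe_out TN) // ltnW.
move=> i j; rewrite leq_eqVlt => /orP[/eqP ijN|ijN] x; last first.
  rewrite -(pe_sqr TN) //; apply: eq_bigr => -[k l] _ /=.
  rewrite ltnS in ijN; have := ltn_ord k; have := ltn_ord l => lj ki.
  by rewrite !T'T //; lia.
have [->|j0] := posnP j.
  by apply: conv2_0r => i'; rewrite /T' /top andbF (pe_0 TN).
have tij : top i j by rewrite /top ijN eqxx.
have T00 y : T 0%N 0%N y = cd y by rewrite (pe_0 TN) (hs_0 fs).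
(* The old operator vanishes here, so [conv2 T i j] consists of the inner terms alone. The new one
   enters only through the two end terms, which add up to the defect. *)
have Tij y : T i j y = 0 by rewrite (pe_out TN) // ijN.
have T'ij y : T' i j y = S i j y by rewrite /T' tij.
have T'00 y : T' 0%N 0%N y = cd y by rewrite T'T.
have ne : (ord_max, ord_max) != (ord0, ord0) :> 'I_i.+1 * 'I_j.+1.
  by rewrite xpair_eqE -!val_eqE /= negb_and orbC -lt0n j0.
have split_ends (U : nat -> nat -> G -> G) : conv2 U i j x =
    U 0%N 0%N (U i j x) + (U i j (U 0%N 0%N x) +
    \sum_(k : 'I_i.+1 * 'I_j.+1 | (k != (ord0, ord0)) && (k != (ord_max, ord_max)))
       U k.1 k.2 (U (i - k.1)%N (j - k.2)%N x)).
  by rewrite /conv2 (bigD1 (ord0, ord0)) //= (bigD1 (ord_max, ord_max)) //= !subn0 !subnn.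
have [_ _ sxE] := SE i j tij.
rewrite split_ends T'00 !T'ij T'00 addrA sxE /defect (split_ends T).
rewrite T00 !Tij linear0 !add0r.
rewrite [X in _ + X](_ : _ = \sum_(k : 'I_i.+1 * 'I_j.+1 |
    (k != (ord0, ord0)) && (k != (ord_max, ord_max)))
       T k.1 k.2 (T (i - k.1)%N (j - k.2)%N x)) ?subrK //.
apply: eq_bigr => -[k l] /andP[k0 km] /=.
have := ltn_ord k; have := ltn_ord l => lj ki.
have : ~~ ((k == i :> nat) && (l == j :> nat)).
  by apply: contra km => /andP[ki' lj']; rewrite xpair_eqE -!val_eqE /= ki'.
have : ~~ ((k == 0 :> nat) && (l == 0 :> nat)).
  by apply: contra k0 => /andP[ki' lj']; rewrite xpair_eqE -!val_eqE /= ki'.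
by move=> ? ?; rewrite !T'T //; lia.
Qed.
End Step.
(** Later stages do not touch total degree i + j, so the entry at (i, j) is read off from stage i +
    j. *)
Lemma full_extension : exists T : nat -> nat -> G -> G,
  [/\ forall i j, linear (T i j),
      forall i j, homogeneous ((i + j).*2%:Z - 1) (T i j),
      forall i, T i 0%N = s i &
      forall i j x, conv2 T i j x = coef i j *: x].
Proof.
pose T0 (i j : nat) : G -> G := if j is 0 then s i else fun=> 0.
have T0E : partial_extension 0 T0.
  split=> //.
  - by case=> [|i] [|j] //; rewrite /T0; [exact: hs_linear fs _|move=> c x y; rewrite scaler0 addr0
      |exact: hs_linear fs _|move=> c x y; rewrite scaler0 addr0].
  - move=> i [|j]; first by rewrite addn0; exact: hs_homog fs i.
    by move=> m x _; rewrite linear0.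
  - by move=> i [].
  - by move=> i j; rewrite leqn0 addn_eq0 => /andP[_ /eqP->] x; exact: conv2_0r.
pose S N := {T | partial_extension N T}.
have nxt N (T : S N) : {T' : S N.+1 |
    forall i j, (i + j <= N)%N -> sval T' i j = sval T i j}.
  by case: T => T /= /extension_step/cid[T' [T'1 T'2]]; exists (exist _ T' T'1).
pose ts N : S N := nat_rect S (exist _ T0 T0E) (fun m T => sval (nxt m T)) N.
have tsE N i j : (i + j <= N)%N -> sval (ts N) i j = sval (ts (i + j)%N) i j.
  move=> /subnK<-; elim: (N - _)%N => // m IHm.
  by rewrite addSn -IHm; apply: (svalP (nxt _ (ts (m + (i + j))%N))); exact: leq_addl.
exists (fun i j => sval (ts (i + j)%N) i j); split.
- by move=> i j; apply: pe_linear (svalP (ts _)) i j.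
- by move=> i j; apply: pe_homog (svalP (ts _)) i j.
- by move=> i; rewrite (pe_0 (svalP (ts _))).
move=> i j x; rewrite -(pe_sqr (svalP (ts (i + j)%N))) //.
apply: eq_bigr => -[k l] _ /=; have := ltn_ord k; have := ltn_ord l => lj ki.
by rewrite (tsE (i + j)%N k l) 1?(tsE (i + j)%N (i - k)%N (j - l)%N) //; lia.
Qed.

Lemma system_extension (b : P) : exists2 s', homotopy_system (f + a * b) s' &
  forall i x, exists z, s' i x = s i x + b *: z.
Proof.
have [T [Tlin Tdeg T0 Tsqr]] := full_extension.
(* The coefficient of t^n once T is replaced by b t: its term for j = 0 is [s n], and all others
   contain [b]. *)
exists (fun n x => \sum_(j < n.+1) b ^+ j *: T (n - j)%N j x); last first.
  move=> n x; rewrite big_ord_recl /= subn0 T0 expr0 scale1r.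
  exists (\sum_(j < n) b ^+ j *: T (n - j.+1)%N j.+1 x); congr (_ + _).
  by rewrite scaler_sumr; apply: eq_bigr => j _; rewrite scalerA -exprS.
split.
- move=> n c x y; rewrite scaler_sumr -big_split; apply: eq_bigr => j _ /=.
  by rewrite Tlin scalerDr !scalerA (mulrC c).
- move=> n m x xm; rewrite linear_sum; apply: eq_bigr => j _; rewrite linearZ /=.
  by congr (_ *: _); rewrite -[RHS](Tdeg _ _ _ _ xm) subnK // -ltnS.
- by move=> x; rewrite big_ord1 T0 expr0 scale1r (hs_0 fs).
move=> n x; pose F k l k' l' := b ^+ (l + l') *: T k l (T k' l' x).
transitivity (\sum_(m < n.+1) b ^+ m *: conv2 T (n - m) m x).
  transitivity (\sum_(i < n.+1) \sum_(j < i.+1) \sum_(l < (n - i).+1)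
      F (i - j)%N j (n - i - l)%N l).
    apply: eq_bigr => i _; apply: eq_bigr => j _.
    rewrite [T _ _ _](linear_sum (linear_pack (Tlin _ _))) scaler_sumr.
    apply: eq_bigr => l _; rewrite [linear_pack _ _](linearZ_LR (linear_pack (Tlin _ _))).
    by rewrite scalerA -exprD.
  transitivity (\sum_(m < n.+1) \sum_(l < m.+1) \sum_(k < (n - m).+1)
      F k l (n - m - k)%N (m - l)%N); last first.
    apply: eq_bigr => m _; rewrite /conv2 -(pair_bigA _
      (fun (k : 'I_(n - m).+1) (l : 'I_m.+1) => T k l (T (n - m - k)%N (m - l)%N x))) /=.
    rewrite exchange_big scaler_sumr; apply: eq_bigr => l _.
    by rewrite scaler_sumr; apply: eq_bigr => k _; rewrite /F subnKC // -ltnS.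
  (* With the exponent of T in the left factor made the outermost index on both sides, the remaining
     sums differ only in their order. *)
  rewrite -(sum_triangle n (fun j k r => \sum_(l < r.+1) F k j (r - l)%N l)).
  rewrite -(sum_triangle n (fun l l' r => \sum_(k < r.+1) F k l (r - k)%N l')).
  apply: eq_bigr => j _.
  exact: (sum_triangleC (n - j) (fun k l r => F k j r l)).
under eq_bigr => m _ do rewrite Tsqr.
case: n => [|[|n]].
- by rewrite big_ord1 /coef /= scale0r scaler0.
- rewrite !big_ord_recl big_ord0 /coef /= expr0 expr1 scale1r addr0.
  by rewrite scalerA -scalerDl mulrC.
rewrite big1 // => m _; rewrite /coef.
case: (m : nat) => [|[|k]]; rewrite !xpair_eqE ?subn0 ?subn1 /= ?andbF /=;
  by rewrite scale0r scaler0.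
Qed.
End Extension.
End HigherHomotopies.

(** * Free resolutions *)

Section FreeModule.
Variable P : comNzRingType.

Definition free_module (K : choiceType) : lmodType P := dsum (fun _ : K => P^o).

Section FreeLift.
Variables (K : choiceType) (W : lmodType P) (v : K -> W).

Fact ray_linear (w : W) : linear (fun c : P^o => c *: w).
Proof. by move=> a c d; rewrite scalerDl scalerA. Qed.

Definition free_lift : {linear free_module K -> W} :=
  dlift (fun i => linear_pack (ray_linear (v i))).

Lemma free_liftE i (c : P^o) : free_lift (dinj i c) = c *: v i.
Proof. exact: dliftE. Qed.
End FreeLift.

Lemma regular_projective : projective P^o.
Proof.
move=> A B g f gsurj; have [a ga] := gsurj (f (1 : P^o)).
exists (linear_pack (ray_linear a)) => c /=; rewrite linearZ /= ga -linearZ.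
by congr (f _); exact: mulr1.
Qed.

Lemma free_projective (K : choiceType) : projective (free_module K).
Proof. by apply: dsum_projective => _; exact: regular_projective. Qed.

(** A projective module embeds in the free module on its own elements, where a regular element acts
    injectively on each coordinate. *)
Lemma projective_torsion_free (X : lmodType P) (f : P) : projective X ->
  GRing.lreg f -> forall x : X, f *: x = 0 -> x = 0.
Proof.
move=> projX regf x fx.
have id_lin : linear (@id X) by [].
have [|h hK] := projX (free_module X) X (free_lift id) (linear_pack id_lin).
  by move=> y; exists (dinj y 1); rewrite free_liftE scale1r.
rewrite -[LHS](hK x : _ = x); have -> : h x = 0; last by rewrite linear0.
apply: dsumP => i; rewrite dsum0E; apply: regf; rewrite mulr0.
have -> : f * h x i = (f *: h x) i by [].
by rewrite -linearZ fx linear0.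
Qed.

(** Sending the basis elements outside the kernel to 0 covers the kernel without forming it as a
    module. *)
Definition kernel_cover (A B : lmodType P) (g : {linear A -> B}) : {linear free_module A -> A} :=
  free_lift (fun x => if g x == 0 then x else 0).

Lemma kernel_coverK (A B : lmodType P) (g : {linear A -> B}) x :
  g (kernel_cover g x) = 0.
Proof.
move: x; apply: dsum_ind => [|x y xE yE|i a]; first by rewrite !linear0.
  by rewrite !linearD xE yE addr0.
rewrite free_liftE linearZ /=; case: eqP => [->|_]; first by rewrite scaler0.
by rewrite linear0 scaler0.
Qed.

Lemma kernel_cover_surj (A B : lmodType P) (g : {linear A -> B}) x :
  g x = 0 -> exists y, kernel_cover g y = x.
Proof. by move=> gx; exists (dinj x 1); rewrite free_liftE gx eqxx scale1r. Qed.

Variable L : lmodType P.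

(** Each step covers the kernel of the previous map, so the iteration runs on maps, bundled with
    their modules, which change at each step. *)
Record res_stage := ResStage {
  st_dom : lmodType P;
  st_cod : lmodType P;
  st_map : {linear st_dom -> st_cod}
}.

Definition res_stage_of (m : nat) : res_stage :=
  iter m (fun s => ResStage (kernel_cover (st_map s))) (ResStage (free_lift (@id L))).

Definition res_term (m : nat) : lmodType P := st_dom (res_stage_of m).
Definition res_term_d (m : nat) : {linear res_term m.+1 -> res_term m} :=
  st_map (res_stage_of m.+1).
Definition res_term_aug : {linear res_term 0 -> L} := st_map (res_stage_of 0).

Lemma res_term_projective m : projective (res_term m).
Proof. by case: m => [|m]; exact: free_projective. Qed.

Lemma res_term_dd m x : res_term_d m (res_term_d m.+1 x) = 0.
Proof. exact: kernel_coverK. Qed.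

Definition res_total : lmodType P := dsum res_term.

Fact res_pr_fin (i : int) (x : res_total) : exists s : seq nat, forall m, m \notin s ->
  (if i == m%:Z then x m else 0) = 0.
Proof. by have [s sx] := dfin x; exists s => m /sx->; rewrite if_same. Qed.
Definition res_pr_fun i x : res_total := DSum (res_pr_fin i x).
Fact res_pr_linear i : linear (res_pr_fun i).
Proof.
move=> a x y; apply: dsumP => m /=.
by case: eqP; rewrite ?scaler0 ?addr0.
Qed.
Definition res_pr i : {linear res_total -> res_total} := linear_pack (@res_pr_linear i).

Fact res_prK i j x : res_pr i (res_pr j x) = if i == j then res_pr j x else 0.
Proof.
apply: dsumP => m /=; have [->|ij] := eqVneq i j; first by rewrite /=; case: eqP.
rewrite dsum0E; case: eqP => // im; case: eqP => // jm.
by rewrite im jm eqxx in ij.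
Qed.

Fact res_gen (x : res_total) : exists2 s : seq (int * res_total),
  {in s, forall p, res_pr p.1 p.2 = p.2} & x = \sum_(p <- s) p.2.
Proof.
have [s sx] := dfin x; exists [seq (m%:Z, dinj m (x m)) | m <- undup s].
  move=> _ /mapP[m _ ->]; apply: dsumP => l /=; case: eqP => // /eqP ml.
  by rewrite dfwith_out.
rewrite big_map /=; apply: dsum_expand; first exact: undup_uniq.
by move=> m; rewrite mem_undup; exact: sx.
Qed.

Definition res_gmod : gmod P := GMod res_prK res_gen.

Fact res_d_fin (x : res_total) : exists s : seq nat, forall m, m \notin s ->
  res_term_d m (x m.+1) = 0.
Proof.
have [s sx] := dfin x; exists (map predn s) => m sm; rewrite sx ?linear0 //.
by apply: contra sm => sm; apply/mapP; exists m.+1.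
Qed.
Definition res_d_fun (x : res_gmod) : res_gmod := DSum (res_d_fin x).
Fact res_d_linear : linear res_d_fun.
Proof.
by move=> a x y; apply: dsumP => m; exact: (linearP (res_term_d m)).
Qed.
Definition res_d : {linear res_gmod -> res_gmod} := linear_pack res_d_linear.

Fact res_dd x : res_d (res_d x) = 0.
Proof. by apply: dsumP => m; exact: res_term_dd. Qed.

Fact res_d_deg i x : res_d (gpr i x) = gpr (i - 1) (res_d x).
Proof.
have iE (m : nat) : (i - 1 == m%:Z) = (i == m.+1%:Z).
  by rewrite subr_eq -PoszD addn1.
apply: dsumP => m; transitivity (if i == m.+1%:Z then res_term_d m ((x : res_total) m.+1) else 0).
  have -> : res_d (gpr i x) m =
    res_term_d m (if i == m.+1%:Z then (x : res_total) m.+1 else 0) by [].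
  by case: ifP => // _; rewrite linear0.
by rewrite -iE.
Qed.

Definition res_complex : complex P := Complex res_dd res_d_deg.

Fact res_aug_linear : linear (fun x : res_complex => res_term_aug ((x : res_total) 0%N)).
Proof. by move=> a x y; exact: (linearP res_term_aug). Qed.

Lemma free_resolution : inhabited (proj_resolution L).
Proof.
constructor; apply: (@ProjResolution P L res_complex (linear_pack res_aug_linear)).
- by apply: dsum_projective => m; exact: res_term_projective.
- by move=> i x i0; apply: dsumP => m /=; case: eqP => // im; rewrite im in i0.
- move=> i x i0; have x0 : (gpr i x : res_total) 0%N = 0 by rewrite /= (negPf i0).
  exact: etrans (congr1 res_term_aug x0) (linear0 _).
- move=> y; pose e : res_term 0 := dinj y 1; exists (dinj 0%N e : res_total).
  have -> : linear_pack res_aug_linear (dinj 0%N e) = res_term_aug e.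
    by rewrite -[in RHS](dinjE e).
  by rewrite [LHS]free_liftE scale1r.
- by move=> x; exact: (kernel_coverK res_term_aug).
move=> x dx ax.
have yE m : {y : res_term m.+1 | res_term_d m y = (x : res_total) m}.
  apply: cid; case: m => [|m]; first exact: (@kernel_cover_surj _ _ res_term_aug).
  apply: (@kernel_cover_surj _ _ (res_term_d m)).
  exact: (congr1 (fun z : res_total => z m) dx).
(* Where the component of [x] is zero, the preimage is 0 and not the chosen one; this keeps the
   support of [y] finite. *)
pose y m : res_term m :=
  if m is m'.+1 then (if (x : res_total) m' == 0 then 0 else sval (yE m')) else 0.
have yfin : exists s : seq nat, forall m, m \notin s -> y m = 0.
  have [s sx] := dfin (x : res_total); exists (map S s) => -[|m] //= sm.
  case: eqP => // -[]; apply: sx.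
  by apply: contra sm; exact: map_f.
exists (DSum yfin : res_total); apply: dsumP => m.
have -> : res_d (DSum yfin) m = res_term_d m (y m.+1) by [].
rewrite /y; case: eqP => [x0|_]; last exact/esym/(svalP (yE m)).
by rewrite linear0.
Qed.
End FreeModule.

(** * The resolution over a hypersurface *)

Section Contraction.
Variables (P : comNzRingType) (L : lmodType P) (G : proj_resolution L).

Lemma homogeneous_gpr (s : G -> G) r : linear s -> homogeneous r s ->
  forall i x, s (gpr i x) = gpr (i + r) (s x).
Proof.
move=> ls sdeg i; apply: homog_ind => [|x y xE yE|j x xj].
- by rewrite !linear0 [s 0](linear0 (linear_pack ls)) linear0.
- by rewrite linearD [LHS](linearD (linear_pack ls)) [s (x + y)](linearD (linear_pack ls)) linearD
    /= xE yE.
rewrite (gpr_homog _ xj) (gpr_homog _ (sdeg _ _ xj)) (inj_eq (addIr _)).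
by case: eqP => // _; exact: (linear0 (linear_pack ls)).
Qed.

(* The graded module G<y>, with [dpin m a] in the role of a y^(m). *)
Definition dpow : lmodType P := dsum (fun _ : nat => gsort G).
Definition dpin (m : nat) : {linear G -> dpow} := dinj (A := fun=> gsort G) m.
Definition dpout (m : nat) : {linear dpow -> G} := dproj (A := fun=> gsort G) m.

Lemma dpinE (m l : nat) a : dpout l (dpin m a) = if m == l then a else 0.
Proof.
case: eqP => [->|/eqP ml]; first exact: (dinjE (A := fun=> gsort G)).
exact: (dinj_neq (A := fun=> gsort G)).
Qed.

Lemma dpowP (x y : dpow) : (forall m : nat, dpout m x = dpout m y) -> x = y.
Proof. exact: dsumP. Qed.

Lemma dpow_ind (T : dpow -> Prop) : T 0 ->
  (forall x y, T x -> T y -> T (x + y)) -> (forall (m : nat) a, T (dpin m a)) ->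
  forall x, T x.
Proof. exact: dsum_ind. Qed.

Fact dpow_pr_fin (i : int) (x : dpow) : exists s : seq nat, forall m, m \notin s ->
  gpr (i - m.*2%:Z) (x m) = 0.
Proof. by have [s sx] := dfin x; exists s => m /sx->; rewrite linear0. Qed.
Definition dpow_pr_fun i x : dpow := DSum (dpow_pr_fin i x).
Fact dpow_pr_linear i : linear (dpow_pr_fun i).
Proof. by move=> a x y; apply: dsumP => m; exact: (linearP (gpr (i - m.*2%:Z))). Qed.
Definition dpow_pr i : {linear dpow -> dpow} := linear_pack (@dpow_pr_linear i).

Lemma dpout_pr i (m : nat) x : dpout m (dpow_pr i x) = gpr (i - m.*2%:Z) (dpout m x).
Proof. by []. Qed.

Lemma dpow_pr_dpin i (m : nat) (a : G) :
  dpow_pr i (dpin m a) = dpin m (gpr (i - m.*2%:Z) a).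
Proof.
apply: dpowP => l; rewrite dpout_pr !dpinE.
by case: eqP => [->|_] //; rewrite linear0.
Qed.

Fact dpow_prK i j x : dpow_pr i (dpow_pr j x) = if i == j then dpow_pr j x else 0.
Proof.
apply: dpowP => m; rewrite !dpout_pr gprK (inj_eq (addIr _)).
by case: eqP; rewrite ?linear0.
Qed.

Fact dpow_gen (x : dpow) : exists2 s : seq (int * dpow),
  {in s, forall p, dpow_pr p.1 p.2 = p.2} & x = \sum_(p <- s) p.2.
Proof.
move: x; apply: dpow_ind => [|x y [s sh ->] [t th ->]|m a].
- by exists [::]; rewrite ?big_nil.
- exists (s ++ t); last by rewrite big_cat.
  by move=> p; rewrite mem_cat => /orP[/sh|/th].
have [s sh ->] := gpr_gen a; exists [seq (p.1 + m.*2%:Z, dpin m p.2) | p <- s].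
  by move=> _ /mapP[p ps ->]; rewrite dpow_pr_dpin addrK sh.
by rewrite big_map linear_sum.
Qed.

Definition dpow_gmod : gmod P := GMod dpow_prK dpow_gen.

Lemma dpow_projective : projective dpow.
Proof. by apply: dsum_projective => _; exact: r_proj. Qed.

Fact dpow_down_fin (x : dpow) : exists s : seq nat, forall m, m \notin s -> x m.+1 = 0.
Proof.
have [s sx] := dfin x; exists (map predn s) => m sm; apply: sx.
by apply: contra sm => sm; apply/mapP; exists m.+1.
Qed.
(** The contraction t, which takes y^(m+1) to y^(m) and kills y^(0); [dpow_up] is a section of
    it. *)
Definition dpow_down_fun (x : dpow) : dpow := DSum (dpow_down_fin x).
Fact dpow_down_linear : linear dpow_down_fun.
Proof. by move=> a x y; apply: dpowP. Qed.
Definition dpow_down : {linear dpow -> dpow} := linear_pack dpow_down_linear.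

Lemma dpow_downE (m : nat) x : dpout m (dpow_down x) = dpout m.+1 x.
Proof. by []. Qed.

Fact dpow_up_fin (x : dpow) : exists s : seq nat, forall m, m \notin s ->
  (if m is m'.+1 then x m' else 0) = 0.
Proof.
have [s sx] := dfin x; exists (map S s) => -[|m] //= sm; apply: sx.
by apply: contra sm; exact: map_f.
Qed.
Definition dpow_up (x : dpow) : dpow := DSum (dpow_up_fin x).

Lemma dpow_upK : cancel dpow_up dpow_down.
Proof. by move=> x; apply: dsumP. Qed.

Section Differential.
Variables (f : P) (s : nat -> G -> G).
Hypothesis fs : homotopy_system f s.

Lemma raug_hs m x : raug G (s m x) = 0.
Proof.
case: m => [|m]; first by rewrite (hs_0 fs) raug_cd.
pose sm := linear_pack (hs_linear fs m.+1); rewrite -[s _ x]/(sm x).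
move: x; apply: homog_ind => [|y z|i y yi]; first by rewrite !linear0.
  by rewrite !linearD => -> ->; rewrite addr0.
case: i yi => [i|i] yi; last by rewrite -yi r_neg // !linear0.
by rewrite /= -(@hs_homog _ _ _ _ _ fs m.+1 _ _ yi) raug_deg //; lia.
Qed.

Fact dpow_d_linear m : linear (fun a : G =>
  \sum_(i < m.+1) dpin (m - i)%N (s i a)).
Proof.
move=> c a b; rewrite scaler_sumr -big_split; apply: eq_bigr => i _.
by rewrite (hs_linear fs) linearP.
Qed.
Definition dpow_d : {linear dpow -> dpow} := dlift (fun m => linear_pack (dpow_d_linear m)).

Lemma dpow_dE m (a : G) :
  dpow_d (dpin m a) = \sum_(i < m.+1) dpin (m - i)%N (s i a).
Proof. exact: dliftE. Qed.

Lemma dpow_d_deg i x : dpow_d (dpow_pr i x) = dpow_pr (i - 1) (dpow_d x).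
Proof.
move: x; apply: dpow_ind => [|x y xE yE|m a].
- by rewrite !linear0.
- by rewrite !linearD xE yE.
rewrite dpow_pr_dpin !dpow_dE linear_sum; apply: eq_bigr => k _.
rewrite dpow_pr_dpin (homogeneous_gpr (hs_linear fs k) (hs_homog fs k)).
by congr (dpin _ (gpr _ _)); have := ltn_ord k; lia.
Qed.

Lemma dpow_d_aug x : raug G (dpout 0 (dpow_d x)) = 0.
Proof.
move: x; apply: dpow_ind => [|x y xE yE|m a].
- by rewrite !linear0.
- by rewrite !linearD xE yE addr0.
rewrite dpow_dE !linear_sum big1 // => k _.
by rewrite dpinE; case: eqP => _; rewrite ?raug_hs ?linear0.
Qed.

(** Collecting the terms of total index n gives the coefficient of t^n in the square of the system,
    so only n = 1 survives. *)
Lemma dpow_dd x : dpow_d (dpow_d x) = f *: dpow_down x.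
Proof.
move: x; apply: dpow_ind => [|x y xE yE|m a].
- by rewrite !linear0 ?scaler0.
- by rewrite [dpow_d (x + y)]linearD [dpow_down _]linearD scalerDr -xE -yE linearD.
rewrite dpow_dE linear_sum; under eq_bigr => i _ do rewrite dpow_dE.
rewrite (sum_triangleC m (fun i k r => dpin r (s k (s i a)))).
rewrite (sum_triangle m (fun k i r => dpin r (s k (s i a)))).
under eq_bigr => n _ do rewrite -linear_sum (hs_sqr fs) (fun_if (dpin _)) linear0.
rewrite -big_mkcond (big_ord1_eq _ (fun n => dpin (m - n)%N (f *: a))).
apply: dpowP => l; rewrite [RHS]linearZ_LR dpow_downE [in RHS]dpinE.
case: m => [|m]; first exact: etrans (linear0 (dpout l)) (esym (scaler0 _ _)).
transitivity (dpout l (dpin m (f *: a))); first by rewrite subn1.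
by rewrite dpinE eqSS; case: eqP => _; rewrite ?scaler0.
Qed.

Hypothesis regf : GRing.lreg f.

(** By hypothesis [x] is a cycle only modulo f, yet it is a boundary before reduction: the
    correction by [dpow_up z] absorbs the multiple of f. *)
Lemma dpow_exact x z : dpow_d x = f *: z -> raug G (dpout 0 x) = 0 ->
  exists y, x = dpow_d y.
Proof.
move=> dx ax; pose x' := x - dpow_d (dpow_up z).
have dx' : dpow_d x' = 0 by rewrite linearB dpow_dd dpow_upK dx subrr.
have ax' : raug G (dpout 0 x') = 0.
  by rewrite linearB linearB ax dpow_d_aug subrr.
have x'0 : x' = dpin 0 (dpout 0 x').
  have fx' : f *: dpow_down x' = 0 by rewrite -dpow_dd dx' linear0.
  have tx' := projective_torsion_free dpow_projective regf fx'.
  apply: dpowP => -[|m]; rewrite dpinE //.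
  exact: (congr1 (dpout m) tx').
have cx' : cd (dpout 0 x') = 0.
  have := congr1 (dpout 0) dx'.
  by rewrite {1}x'0 dpow_dE big_ord1 dpinE (hs_0 fs) linear0.
have [g gE] := r_exact cx' ax'; exists (dpow_up z + dpin 0 g).
rewrite linearD dpow_dE big_ord1 (hs_0 fs) -gE -x'0 /x'.
by rewrite addrC subrK.
Qed.
End Differential.
End Contraction.

(** * Reduction modulo [f] *)

Section ModQuotient.
Variables (P : comNzRingType) (f : P).

Section Module.
Variable A : lmodType P.

Definition multiple : {pred A} := fun x => `[< exists y, x = f *: y >].

Fact multiple_zmod : zmod_closed multiple.
Proof.
split; first by apply/asboolP; exists 0; rewrite scaler0.
move=> x y /asboolP[u ->] /asboolP[v ->]; apply/asboolP.
by exists (u - v); rewrite scalerBr.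
Qed.
HB.instance Definition _ := GRing.isZmodClosed.Build A multiple multiple_zmod.

Definition modf := Quotient.quot multiple.
HB.instance Definition _ := GRing.Zmodule.on modf.

Definition mclass (x : A) : modf := \pi_modf x.

Lemma mclassP x y : mclass x = mclass y <-> exists z, x = y + f *: z.
Proof.
split=> [/eqP|[z ->]].
  rewrite piE Quotient.equivE => /asboolP[z zE].
  by exists z; rewrite -zE addrC subrK.
apply/eqP; rewrite piE Quotient.equivE; apply/asboolP; exists z.
by rewrite addrC addKr.
Qed.

Lemma mclass_ind (T : modf -> Prop) : (forall x, T (mclass x)) -> forall h, T h.
Proof. by move=> Tx h; rewrite -[h]reprK. Qed.

Lemma mclass_repr x : exists z, repr (mclass x) = x + f *: z.
Proof. by apply/mclassP; exact: reprK. Qed.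

Definition mscale a (h : modf) : modf := mclass (a *: repr h).

Fact mscaleE a x : mscale a (mclass x) = mclass (a *: x).
Proof.
apply/mclassP; have [z ->] := mclass_repr x; exists (a *: z).
by rewrite scalerDr !scalerA (mulrC f).
Qed.

Fact mclassD x y : mclass (x + y) = mclass x + mclass y.
Proof. exact: raddfD. Qed.

Fact mscaleA a b h : mscale a (mscale b h) = mscale (a * b) h.
Proof. by elim/mclass_ind: h => x; rewrite !mscaleE scalerA. Qed.
Fact mscale1 : left_id 1 mscale.
Proof. by elim/mclass_ind => x; rewrite mscaleE scale1r. Qed.
Fact mscaleDr : right_distributive mscale +%R.
Proof.
move=> a; elim/mclass_ind => x; elim/mclass_ind => y.
by rewrite -mclassD !mscaleE scalerDr mclassD.
Qed.
Fact mscaleDl h : {morph mscale^~ h : a b / a + b}.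
Proof. by move=> a b; elim/mclass_ind: h => x; rewrite !mscaleE scalerDl mclassD. Qed.
HB.instance Definition _ := GRing.Zmodule_isLmodule.Build P modf
  mscaleA mscale1 mscaleDr mscaleDl.

Fact mclass_linear : linear mclass.
Proof. by move=> a x y; rewrite mclassD -mscaleE. Qed.
HB.instance Definition _ := GRing.isLinear.Build P A modf _ mclass mclass_linear.

Lemma mclass0 x : mclass (f *: x) = 0.
Proof. by rewrite -(linear0 mclass); apply/mclassP; exists x; rewrite add0r. Qed.

Lemma mclass_eq0 x : mclass x = 0 -> exists z, x = f *: z.
Proof.
by rewrite -(linear0 mclass) => /mclassP[z ->]; exists z; rewrite add0r.
Qed.
End Module.

Section Map.
Variables (A B : lmodType P) (g : {linear A -> B}).

Definition modf_map (h : modf A) : modf B := mclass (g (repr h)).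

Lemma modf_mapE x : modf_map (mclass x) = mclass (g x).
Proof.
have [z zE] := mclass_repr x; apply/mclassP; exists (g z).
by rewrite zE linearD linearZ.
Qed.

Fact modf_map_linear : linear modf_map.
Proof.
move=> a; elim/mclass_ind => x; elim/mclass_ind => y.
by rewrite -(mclass_linear a x y) !modf_mapE linearP mclass_linear.
Qed.
End Map.
Definition modf_lin (A B : lmodType P) (g : {linear A -> B}) := linear_pack (modf_map_linear g).
End ModQuotient.

Section Reduction.
Variables (P Q : comNzRingType) (u : {rmorphism P -> Q}) (f : P).
Hypothesis u_surj : forall c, exists a, u a = c.
Hypothesis u_ker : forall a, u a = 0 -> exists b, a = b * f.
Hypothesis uf : u f = 0.

Lemma modf_annihilated (A : lmodType P) : annihilated u (modf f A).
Proof.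
move=> a; elim/mclass_ind => x /u_ker[b ->].
rewrite -(mclass0 f (b *: x)) scalerA mulrC; exact: mscaleE.
Qed.

Definition reduced (A : lmodType P) : lmodType Q :=
  descent (@modf_annihilated A) u_surj.
Definition reduce (A : lmodType P) (x : A) : reduced A := mclass f x.

Lemma reducedZ (A : lmodType P) p (x : reduced A) : u p *: x = p *: (x : modf f A) :> modf f A.
Proof. exact: descent_scaleE. Qed.

Lemma reduce_linear (A : lmodType P) p (x y : A) :
  reduce (p *: x + y) = u p *: reduce x + reduce y.
Proof. by rewrite /reduce mclass_linear; congr (_ + _); rewrite reducedZ. Qed.

Definition reduced_map (A : lmodType P) (g : {linear A -> A}) :
  {linear reduced A -> reduced A} := descent_map (modf_lin f g).

Lemma reduced_mapE (A : lmodType P) (g : {linear A -> A}) x :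
  reduced_map g (reduce x) = reduce (g x).
Proof. exact: modf_mapE. Qed.

Lemma reduced_ind (A : lmodType P) (T : reduced A -> Prop) :
  (forall x, T (reduce x)) -> forall h, T h.
Proof. exact: mclass_ind. Qed.

Section Gmod.
Variable A : gmod P.

Fact modf_prK i j (x : modf f A) : modf_lin f (gpr i) (modf_lin f (gpr j) x) =
  if i == j then modf_lin f (gpr j) x else 0.
Proof.
elim/mclass_ind: x => x; rewrite /= !modf_mapE gprK.
by case: eqP => _ //; exact: linear0.
Qed.

Fact modf_gen (x : modf f A) : exists2 s : seq (int * modf f A),
  {in s, forall p, modf_lin f (gpr p.1) p.2 = p.2} & x = \sum_(p <- s) p.2.
Proof.
elim/mclass_ind: x => x; have [s sh ->] := gpr_gen x.
exists [seq (p.1, mclass f p.2) | p <- s].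
  by move=> _ /mapP[p ps ->]; rewrite /= modf_mapE sh.
by rewrite big_map; exact: (linear_sum (@mclass _ f A)).
Qed.

Definition modf_gmod : gmod P := GMod modf_prK modf_gen.
Definition reduced_gmod : gmod Q :=
  @descent_gmod P Q u u_surj modf_gmod (@modf_annihilated A).
End Gmod.

(** A map out of X/fX is lifted over P, where X is projective; the lift factors through X/fX because
    f acts as zero on every Q-module. *)
Lemma reduced_projective (X : lmodType P) : projective X -> projective (reduced X).
Proof.
move=> projX A B g h gsurj.
have g_lin : linear (fun x : restr u A => g x : restr u B) by move=> a x y; exact: (linearP g).
have h_lin : linear (fun x : X => h (reduce x) : restr u B).
  by move=> a x y; rewrite reduce_linear; exact: (linearP h).
have [|k kE] := projX _ _ (linear_pack g_lin) (linear_pack h_lin); first exact: gsurj.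
pose k' (x : reduced X) : A := k (repr (x : modf f X)).
have k'E x : k' (reduce x) = k x.
  rewrite /k' /reduce; have [z ->] := mclass_repr f x.
  by rewrite linearD linearZ_LR -[f *: _]/(u f *: (k z : A)) uf scale0r addr0.
have k'_lin : linear k'.
  move=> c; have [a <-] := u_surj c; elim/reduced_ind => x; elim/reduced_ind => y.
  by rewrite -reduce_linear !k'E; exact: (linearP k).
exists (linear_pack k'_lin); elim/reduced_ind => x; rewrite [linear_pack _ _]k'E; exact: kE.
Qed.

Section Resolution.
Variables (L : lmodType P) (L' : lmodType Q) (e : L -> L').
Hypothesis le : semilinear (idfun : {rmorphism P -> P}) u e.
Hypothesis e_bij : bijective e.
Hypothesis regf : GRing.lreg f.
Variables (G : proj_resolution L) (s : nat -> G -> G).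
Hypothesis fs : homotopy_system f s.

Let D : {linear reduced_gmod (dpow_gmod G) -> reduced_gmod (dpow_gmod G)} :=
  reduced_map (dpow_d fs).

Fact dpow_bar_dd x : D (D x) = 0.
Proof.
elim/reduced_ind: x => x; rewrite [X in D X]reduced_mapE [LHS]reduced_mapE dpow_dd.
exact: mclass0.
Qed.

Fact dpow_bar_deg i x : D (gpr i x) = gpr (i - 1) (D x).
Proof.
elim/reduced_ind: x => x.
have DE y : D (reduce y) = reduce (dpow_d fs y) by exact: reduced_mapE.
by rewrite [X in D X]reduced_mapE !DE [RHS]reduced_mapE dpow_d_deg.
Qed.

Definition dpow_bar : complex Q := Complex dpow_bar_dd dpow_bar_deg.

Definition bar_aug (x : dpow_bar) : L' := e (raug G (dpout G 0 (repr (x : modf f (dpow G))))).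

(** The action of f on [L] is that of [u f] = 0 on [L']. This makes the augmentation well defined
    modulo f. *)
Lemma fL (l : L) : f *: l = 0.
Proof.
have [e' eK _] := e_bij; apply: (can_inj eK).
by rewrite (semilinear0 le) (semilinearZ le (f : P)) uf scale0r.
Qed.

Lemma bar_augE (x : dpow G) : bar_aug (reduce x) = e (raug G (dpout G 0 x)).
Proof.
rewrite /bar_aug /reduce; have [z ->] := mclass_repr f x.
by rewrite !linearD !linearZ_LR fL addr0.
Qed.

Fact bar_aug_linear : linear bar_aug.
Proof.
move=> c; have [a <-] := u_surj c; elim/reduced_ind => x; elim/reduced_ind => y.
by rewrite -reduce_linear !bar_augE !linearP -le.
Qed.

(** In the application [L] and [L'] are the residue field over P and over P/(f), and [e] is the
    identity. The definition stays transparent so that its complex is recognised as [dpow_bar]. *)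
Definition dpow_resolution : proj_resolution L'.
Proof.
apply: (@ProjResolution Q L' dpow_bar (linear_pack bar_aug_linear)).
- exact: reduced_projective (@dpow_projective _ _ G).
- move=> i x i0; elim/reduced_ind: x => x; rewrite [LHS]reduced_mapE.
  rewrite (_ : gpr i x = 0); first exact: linear0.
  by apply: dpowP => m; rewrite dpout_pr r_neg ?linear0 //; lia.
- move=> i x i0; elim/reduced_ind: x => x; rewrite [gpr _ _]reduced_mapE.
  rewrite [LHS]bar_augE dpout_pr raug_deg; first exact: semilinear0 le.
  by rewrite subr0.
- move=> y; have [e' eK e'K] := e_bij; have [x xE] := raug_surj G (e' y).
  by exists (reduce (dpin G 0 x)); rewrite [LHS]bar_augE dpinE eqxx xE e'K.
- elim/reduced_ind => x; rewrite [cd _]reduced_mapE [LHS]bar_augE dpow_d_aug.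
  exact: semilinear0 le.
elim/reduced_ind => x; rewrite [cd _]reduced_mapE [linear_pack _ _]bar_augE => dx ax.
have [z dxE] := mclass_eq0 dx.
have [|y ->] := dpow_exact regf dxE.
  by apply: (bij_inj e_bij); rewrite ax (semilinear0 le).
by exists (reduce y); rewrite [RHS]reduced_mapE.
Defined.
End Resolution.
End Reduction.

(** * Tensor products with M *)

Section ReducedTensor.
Variables (P Q R : comNzRingType) (u : {rmorphism P -> Q}) (f : P).
Hypothesis u_surj : forall c, exists a, u a = c.
Hypothesis u_ker : forall a, u a = 0 -> exists b, a = b * f.
Hypothesis uf : u f = 0.
Variables (v : {rmorphism P -> R}) (v' : {rmorphism Q -> R}).
Hypothesis vE : forall a, v a = v' (u a).
Variables (X : gmod P) (M : complex R).

Local Notation MP := (restr_complex v M).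
Local Notation MQ := (restr_complex v' M).
Local Notation Xbar := (reduced_gmod u_surj u_ker X).

Fact reduce_tensor_bilin : bilin (fun (x : X) (m : MP) =>
  tens (reduce u_surj u_ker x) (m : MQ) : restr u (tensor Xbar MQ)).
Proof.
split=> [m a x x'|x a m m'].
  rewrite reduce_linear [LHS](@tensDl Q Xbar MQ) (@tensZl Q Xbar MQ).
  by [].
rewrite -[RHS]/(u a *: tens (reduce u_surj u_ker x) (m : MQ) +
  tens (reduce u_surj u_ker x) (m' : MQ)).
rewrite -(@tensZr Q Xbar MQ) -(@tensDr Q Xbar MQ); congr (tens _ (_ + _)).
by rewrite [LHS]/(v a *: (m : M)) vE.
Qed.

Definition reduce_tensor : {linear tensor X MP -> restr u (tensor Xbar MQ)} :=
  tlift reduce_tensor_bilin.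

Lemma reduce_tensorE x (m : MP) :
  reduce_tensor (tens x m) = tens (reduce u_surj u_ker x) (m : MQ) :> tensor Xbar MQ.
Proof. exact: (tliftE reduce_tensor_bilin x m). Qed.

Lemma reduce_tensor_semilinear : semilinear (idfun : {rmorphism P -> P}) u
  (reduce_tensor : tensor X MP -> tensor Xbar MQ).
Proof. by move=> a x y; exact: (linearP reduce_tensor). Qed.

Fact tensor_kernel : annihilated u (tensor X MP).
Proof.
move=> a t ua; move: t; apply: tensor_ind => [|t t' tE t'E|i j x m _ _].
- by rewrite scaler0.
- by rewrite scalerDr tE t'E addr0.
rewrite -tensZr [X in tens x X](_ : _ = 0) ?tens0r //.
have vm : v a *: (m : M) = 0 by rewrite vE ua rmorph0 scale0r.
exact: vm.
Qed.

Lemma tens_mult x (m : MP) : tens (f *: x) m = 0 :> tensor X MP.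
Proof. by rewrite tensZl (tensor_kernel _ uf). Qed.

(** Inverse to reduction: X (x)_P M is already a Q-module because the kernel of [u] acts as zero on
    M, and its tensors depend on x only modulo f. *)
Definition lift_bilin_fun (x : Xbar) (m : MQ) : descent tensor_kernel u_surj :=
  tens (repr (x : modf f X)) (m : MP).

Lemma lift_bilinE x m : lift_bilin_fun (reduce u_surj u_ker x) m = tens x (m : MP).
Proof.
rewrite /lift_bilin_fun /reduce; have [z ->] := mclass_repr f x.
by rewrite tensDl tens_mult addr0.
Qed.

Fact lift_bilin : bilin lift_bilin_fun.
Proof.
split=> [m c|x c m m']; have [a <-] := u_surj c.
  elim/reduced_ind => x; elim/reduced_ind => x'.
  rewrite -reduce_linear !lift_bilinE tensDl tensZl; congr (_ + _).
  exact/esym/descent_scaleE.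
elim/reduced_ind: x => x; rewrite !lift_bilinE.
rewrite [X in tens x X](_ : _ = (a *: (m : MP) + (m' : MP))).
  rewrite tensDr tensZr; congr (_ + _).
  exact/esym/descent_scaleE.
by congr (_ + _); rewrite [RHS]/(v a *: (m : M)) vE.
Qed.

Lemma reduce_tensor_bij : bijective (reduce_tensor : tensor X MP -> tensor Xbar MQ).
Proof.
pose g := tlift lift_bilin; exists g => t.
  move: t; apply: tensor_ind => [|t t' tE t'E|i j x m _ _].
  - by rewrite linear0 [LHS](linear0 g).
  - by rewrite linearD [LHS](linearD g); congr (_ + _).
  by rewrite reduce_tensorE [LHS]tliftE lift_bilinE.
move: t; apply: tensor_ind => [|t t' tE t'E|i j x m _ _].
- exact: etrans (congr1 reduce_tensor (linear0 g)) (linear0 reduce_tensor).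
- apply: etrans (congr1 reduce_tensor (linearD g t t')) _.
  apply: etrans (linearD reduce_tensor (g t) (g t')) _.
  by congr (_ + _).
rewrite [X in reduce_tensor X]tliftE; elim/reduced_ind: x => x.
by rewrite lift_bilinE reduce_tensorE.
Qed.

Lemma reduce_tensor_deg n t :
  reduce_tensor (tpr X MP n t) = tpr Xbar MQ n (reduce_tensor t).
Proof.
move: t; apply: tensor_ind => [|t t' tE t'E|i j x m xi mj].
- by rewrite !linear0.
- by rewrite !linearD tE t'E.
have xi' : gpr i (reduce u_surj u_ker x : Xbar) = reduce u_surj u_ker x.
  by rewrite [LHS]reduced_mapE xi.
rewrite (tprE _ xi mj) reduce_tensorE (tprE _ xi' (mj : gpr j (m : MQ) = m)).
by case: eqP => _; [rewrite reduce_tensorE | rewrite linear0].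
Qed.
End ReducedTensor.

(** * The operator on G<y> (x)_P M induced by a system *)

Section TwistedTensor.
Variables (P R : comNzRingType) (v : {rmorphism P -> R}) (M : complex R).
Variables (L : lmodType P) (G : proj_resolution L).
Local Notation MP := (restr_complex v M).

Fact dpow0_dd (x : dpow_gmod G) :
  dpow_d (trivial_system G) (dpow_d (trivial_system G) x) = 0.
Proof. by rewrite dpow_dd scale0r. Qed.

(** Besides being the complex of the trivial system, it carries the grading and the signs for all
    other systems, whose D is in general no differential over P. *)
Definition dpow0 : complex P :=
  @Complex P (dpow_gmod G) (dpow_d (trivial_system G)) dpow0_dd
    (dpow_d_deg (trivial_system G)).

Section Twist.
Variables (f : P) (s : nat -> G -> G).
Hypothesis fs : homotopy_system f s.

Fact twist_bilin : bilin (fun (x : dpow0) (m : MP) =>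
  tens (dpow_d fs x : dpow0) m + tens (gsign x) (cd m) : tensor dpow0 MP).
Proof.
split=> [m a x x'|x a m m'].
  rewrite [dpow_d fs _]linearP [gsign _]linearP !tensDl !tensZl scalerDr.
  by rewrite addrACA.
by rewrite [cd _]linearP !tensDr !tensZr scalerDr addrACA.
Qed.

(* The differential of G<y> (x) M, which squares to zero only because f
   annihilates M. *)
Definition twist : {linear tensor dpow0 MP -> tensor dpow0 MP} := tlift twist_bilin.

Lemma twistE x m : twist (tens x m) = tens (dpow_d fs x : dpow0) m + tens (gsign x) (cd m).
Proof. exact: (tliftE twist_bilin x m). Qed.

Variables (Q : comNzRingType) (u : {rmorphism P -> Q}).
Hypothesis u_surj : forall c, exists a, u a = c.
Hypothesis u_ker : forall a, u a = 0 -> exists b, a = b * f.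
Hypothesis uf : u f = 0.
Variable v' : {rmorphism Q -> R}.
Hypothesis vE : forall a, v a = v' (u a).
Local Notation MQ := (restr_complex v' M).
Local Notation Xbar := (dpow_bar u_surj u_ker fs).

Lemma gsign_bar (x : dpow0) :
  gsign (reduce u_surj u_ker x : Xbar) = reduce u_surj u_ker (gsign x).
Proof.
move: x; apply: homog_ind => [|x y xE yE|i x xi].
- have r0 : reduce u_surj u_ker (0 : dpow_gmod G) = 0 := linear0 (@mclass P f _).
  by rewrite !linear0 [X in gsign X]r0 r0 linear0.
- have rD (y z : dpow_gmod G) : reduce u_surj u_ker (y + z) =
    reduce u_surj u_ker y + reduce u_surj u_ker z := linearD (@mclass P f _) y z.
  rewrite [gsign (x + y)]linearD [X in gsign X]rD [RHS]rD -xE -yE.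
  exact: linearD.
have xi' : gpr i (reduce u_surj u_ker x : Xbar) = reduce u_surj u_ker x.
  by rewrite [LHS]reduced_mapE; 
    exact: (congr1 (fun y : dpow_gmod G => reduce u_surj u_ker y) xi).
rewrite (gsignE xi') (gsignE xi).
have -> : (-1) ^+ absz i = u ((-1) ^+ absz i) by rewrite rmorphXn rmorphN1.
by rewrite -[in RHS](addr0 (_ *: x)) reduce_linear [reduce _ _ 0](linear0 (@mclass P f _))
  addr0.
Qed.

Local Notation rt := (reduce_tensor u_surj u_ker vE (dpow_gmod G) M).

Lemma reduce_tensor_twist t : rt (twist t) = td Xbar MQ (rt t : tensor Xbar MQ).
Proof.
pose r := rt; pose D : {linear tensor Xbar MQ -> tensor Xbar MQ} := td Xbar MQ.
change (r (twist t) = D (r t)).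
move: t; apply: tensor_ind => [|t t' tE t'E|i j x m _ _].
- rewrite linear0; apply: etrans (linear0 r) _; apply: esym.
  exact: etrans (congr1 D (linear0 r)) (linear0 D).
- rewrite linearD; apply: etrans (linearD r _ _) _; apply: esym.
  apply: etrans (congr1 D (linearD r t t')) _; apply: etrans (linearD D (r t) (r t')) _.
  by congr (_ + _).
rewrite twistE; apply: etrans (linearD r _ _) _; apply: esym.
apply: etrans (congr1 D (reduce_tensorE _ _ _ x m)) _.
apply: etrans (tdE (A := Xbar) (B := MQ) _ _) _.
congr (_ + _).
  rewrite [cd _]reduced_mapE; exact/esym/(reduce_tensorE u_surj u_ker vE).
rewrite gsign_bar; exact/esym/(reduce_tensorE u_surj u_ker vE).
Qed.
End Twist.
End TwistedTensor.

(** * Systems that agree modulo [I] *)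

Section Congruence.
Variables (P : comNzRingType) (I : {pred P}).

Definition congruent (V : lmodType P) (x y : V) : Prop :=
  exists2 s : seq (P * V), {in s, forall p, p.1 \in I} &
    x = y + \sum_(p <- s) p.1 *: p.2.

Lemma congruent_refl (V : lmodType P) (x : V) : congruent x x.
Proof. by exists [::] => //; rewrite big_nil addr0. Qed.

Lemma congruent_trans (V : lmodType P) (x y z : V) :
  congruent x y -> congruent y z -> congruent x z.
Proof.
move=> [s sI ->] [t tI ->]; exists (t ++ s); last by rewrite big_cat addrA.
by move=> p; rewrite mem_cat => /orP[/tI|/sI].
Qed.

Variables (R : comNzRingType) (v : {rmorphism P -> R}) (M : complex R).
Hypothesis vI : forall a, a \in I -> v a = 0.
Local Notation MP := (restr_complex v M).

Lemma congruent_tens (V : lmodType P) (X : gmod P) (g : {linear V -> X}) (x y : V)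
    (m : MP) : congruent x y -> tens (g x) m = tens (g y) m :> tensor X MP.
Proof.
move=> [s sI ->]; rewrite linearD tensDl linear_sum.
apply: etrans (addr0 _); congr (_ + _).
rewrite big_seq; elim/big_ind: _ => [|z z' zm z'm|p ps].
- by rewrite tens0l.
- by rewrite tensDl zm z'm addr0.
rewrite linearZ tensZl -tensZr.
have vm : v p.1 *: (m : M) = 0 by rewrite vI ?scale0r //; exact: sI.
by rewrite [X in tens _ X](vm : p.1 *: m = 0) tens0r.
Qed.

Variables (L : lmodType P) (G : proj_resolution L).

(** Elements of [I] move across the tensor sign onto M, where they act as zero. *)
Lemma twist_congruent (f g : P) (s t : nat -> G -> G)
    (fs : homotopy_system f s) (gt : homotopy_system g t) :
  (forall i x, congruent (s i x) (t i x)) ->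
  forall w, twist v M fs w = twist v M gt w.
Proof.
move=> st; apply: tensor_ind => [|w w' wE w'E|i j x m _ _].
- by rewrite !linear0.
- by rewrite !linearD wE w'E.
rewrite !twistE; congr (_ + _).
move: x; apply: dpow_ind => [|x y xE yE|l a].
- by rewrite !linear0.
- by rewrite !linearD (@tensDl P (dpow0 G) MP) (@tensDl P (dpow0 G) MP) xE yE.
rewrite !dpow_dE; elim/big_ind2: _ => // [x x' y y' xE yE|k _].
  by rewrite (@tensDl P (dpow0 G) MP) (@tensDl P (dpow0 G) MP) xE yE.
exact: (congruent_tens (X := dpow0 G) (dpin G (l - k)%N) m (st k a)).
Qed.
End Congruence.

(** One use of [system_extension] for each product a b in the sum: a in [n] kills [L], and b in [I]
    makes the change vanish modulo [I]. *)
Lemma system_ideal_prod (P : comNzRingType) (n I : idealr P) (L : lmodType P)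
    (G : proj_resolution L) (f h : P) (s : nat -> G -> G) :
  (forall a, a \in n -> forall y : L, a *: y = 0) ->
  homotopy_system f s -> ideal_prod n I h ->
  exists2 t, homotopy_system (f + h) t & forall i x, congruent I (t i x) (s i x).
Proof.
move=> nL fs [r rnI ->]; elim: r rnI => [|[a b] r IHr] rnI.
  by exists s; [rewrite big_nil addr0 | move=> i x; exact: congruent_refl].
have [|t ht ts] := IHr; first by move=> p pr; apply: rnI; rewrite inE pr orbT.
have [/= an bI] := rnI _ (mem_head _ _).
have [t' ht' t't] := system_extension ht (nL a an) b.
exists t'; first by rewrite big_cons /= addrCA addrC.
move=> i x; apply: congruent_trans (ts i x); have [z ->] := t't i x.
by exists [:: (b, z)]; [move=> p; rewrite inE => /eqP-> | rewrite big_seq1].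
Qed.

Section Reductions.
Variables (P R : comNzRingType) (v : {rmorphism P -> R}) (M : complex R).
Variables (L : lmodType P) (G : proj_resolution L).
Variables (Q Q' : comNzRingType) (u : {rmorphism P -> Q}) (u' : {rmorphism P -> Q'}).
Variables (f g : P) (s t : nat -> G -> G).
Hypothesis u_surj : forall c, exists a, u a = c.
Hypothesis u_ker : forall a, u a = 0 -> exists b, a = b * f.
Hypothesis uf : u f = 0.
Hypothesis u'_surj : forall c, exists a, u' a = c.
Hypothesis u'_ker : forall a, u' a = 0 -> exists b, a = b * g.
Hypothesis u'g : u' g = 0.
Variables (w : {rmorphism Q -> R}) (w' : {rmorphism Q' -> R}).
Hypothesis vE : forall a, v a = w (u a).
Hypothesis vE' : forall a, v a = w' (u' a).
Variables (fs : homotopy_system f s) (gt : homotopy_system g t).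

Local Notation Cf := (tensor_complex (dpow_bar u_surj u_ker fs) (restr_complex w M)).
Local Notation Cg := (tensor_complex (dpow_bar u'_surj u'_ker gt) (restr_complex w' M)).
Local Notation rf := (reduce_tensor u_surj u_ker vE (dpow_gmod G) M).
Local Notation rg := (reduce_tensor u'_surj u'_ker vE' (dpow_gmod G) M).

(** Lift along the inverse of one reduction and descend along the other; on the module in the middle
    the two operators agree. *)
Lemma piso_twist_eq : (forall z, twist v M fs z = twist v M gt z) ->
  piso u u' (homology_gmod Cf) (homology_gmod Cg).
Proof.
move=> tw.
have [h hK Kh] := reduce_tensor_bij u_surj u_ker uf vE (dpow_gmod G) M.
have := reduce_tensor_bij u'_surj u'_ker u'g vE' (dpow_gmod G) M => bg.
apply: (@chain_iso _ _ _ u u' Cf Cg (fun z => rg (h z))).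
- move=> p y z; have -> : h (u p *: y + z) = p *: h y + h z.
    by apply: (can_inj hK); rewrite Kh [RHS](reduce_tensor_semilinear _ _ _) !Kh.
  exact: (reduce_tensor_semilinear u'_surj u'_ker vE').
- move=> i z; rewrite -{1}[z]Kh.
  have -> : h (gpr i (rf (h z) : Cf)) = tpr _ _ i (h z).
    by apply: (can_inj hK); rewrite Kh; exact/esym/(reduce_tensor_deg u_surj u_ker vE).
  exact: (reduce_tensor_deg u'_surj u'_ker vE').
- move=> z; have -> : h (cd z) = twist v M fs (h z).
    apply: (can_inj hK); rewrite Kh [RHS]reduce_tensor_twist.
    exact: (congr1 (@cd Q Cf) (esym (Kh z))).
  by rewrite tw; exact: reduce_tensor_twist.
by apply: (bij_comp bg); exists rf.
Qed.

Lemma piso_twist_trivial :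
  (forall z, twist v M fs z = twist v M (trivial_system G) z) ->
  piso (idfun : {rmorphism P -> P}) u
    (homology_gmod (tensor_complex (dpow0 G) (restr_complex v M))) (homology_gmod Cf).
Proof.
move=> tw.
have td_twist z : td (dpow0 G) (restr_complex v M) z = twist v M (trivial_system G) z.
  move: z; apply: tensor_ind => [|z z' zE z'E|i j x m _ _].
  - by rewrite !linear0.
  - by rewrite !linearD zE z'E.
  by rewrite [LHS]tdE twistE.
apply: (@chain_iso _ _ _ _ _ (tensor_complex (dpow0 G) (restr_complex v M)) Cf rf).
- exact: reduce_tensor_semilinear.
- exact: reduce_tensor_deg.
- move=> z; rewrite -[RHS](reduce_tensor_twist fs u_surj u_ker vE z) tw.
  exact: (congr1 rf (td_twist z)).
exact: reduce_tensor_bij.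
Qed.
End Reductions.

(** * The trivial system *)

Section DividedPowerHomology.
Variables (P k : comNzRingType) (phi : {rmorphism P -> k}).
Hypothesis phi_surj : forall c, exists a, phi a = c.
Variables (N C : complex P) (inj : nat -> {linear N -> C}) (out : nat -> {linear C -> N}).
Hypothesis inj_cd : forall j x, inj j (cd x) = cd (inj j x).
Hypothesis out_cd : forall j x, out j (cd x) = cd (out j x).
Hypothesis out_inj : forall i j x, out j (inj i x) = if i == j then x else 0.
Hypothesis out_deg : forall i j x, out j (gpr i x) = gpr (i - j.*2%:Z) (out j x).
Hypothesis expansion : forall x, exists b, forall c, (b <= c)%N ->
  x = \sum_(j < c) inj j (out j x).
Hypothesis annN : annihilated phi (homology_gmod N).

Local Notation T := (descent_gmod phi_surj annN).
Local Notation TD := (tensor T (divided_power k)).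

Fact idfun_semilinear (U V : lmodType P) (g : {linear U -> V}) :
  semilinear (idfun : {rmorphism P -> P}) idfun g.
Proof. by move=> a x y; exact: linearP. Qed.

Let hout j : homology C -> homology N :=
  hmap (idfun_semilinear (out j)) (out_cd j).
Let hinj j : homology N -> homology C :=
  hmap (idfun_semilinear (inj j)) (inj_cd j).

Fact hout_linear j : linear (hout j).
Proof. exact: (@hmap_semilinear _ _ _ _ _ _ _ _ (idfun_semilinear (out j)) (out_cd j)). Qed.
Fact hinj_linear j : linear (hinj j).
Proof. exact: (@hmap_semilinear _ _ _ _ _ _ _ _ (idfun_semilinear (inj j)) (inj_cd j)). Qed.
Definition Hout j := linear_pack (hout_linear j).
Definition Hinj j := linear_pack (hinj_linear j).

Lemma Hout_Hinj i j h : Hout j (Hinj i h) = if i == j then h else 0.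
Proof.
elim/homology_ind: h => z.
rewrite [Hinj i _](hmapE (idfun_semilinear (inj i)) (inj_cd i) z).
rewrite [LHS](hmapE (idfun_semilinear (out j)) (out_cd j)).
case: eqP => ij; last rewrite -[RHS](raddf0 (\pi_(homology N))).
all: congr (\pi_(homology N) _); apply: val_inj; rewrite /= out_inj.
  by rewrite ij eqxx.
by case: eqP.
Qed.

Lemma Hexpansion h : exists b, forall c, (b <= c)%N -> h = \sum_(j < c) Hinj j (Hout j h).
Proof.
elim/homology_ind: h => z; have [b zE] := expansion (val z); exists b => c bc.
have hE j : Hinj j (Hout j (\pi_(homology C) z)) = \pi_(homology C)
    (Cycle (cycle_image (idfun_semilinear (inj j)) (inj_cd j)
      (Cycle (cycle_image (idfun_semilinear (out j)) (out_cd j) z)))).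
  rewrite [Hout j _](hmapE (idfun_semilinear (out j)) (out_cd j) z).
  exact: (hmapE (idfun_semilinear (inj j)) (inj_cd j)).
under eq_bigr => j _ do rewrite hE.
rewrite -(raddf_sum (\pi_(homology C))); congr (\pi_(homology C) _).
by apply: val_inj; rewrite raddf_sum; exact: zE.
Qed.

Lemma Hout_fin h : exists b, forall j, (b <= j)%N -> Hout j h = 0.
Proof.
have [b hE] := Hexpansion h; exists b => j bj.
rewrite {1}(hE b (leqnn b)) linear_sum big1 // => i _.
by rewrite Hout_Hinj; case: eqP => // ij; have := ltn_ord i; rewrite ij ltnNge bj.
Qed.

Definition dp_map (h : homology C) : TD :=
  \sum_(j \in [set: nat]) tens (Hout j h : T) ('X^j : divided_power k).

Lemma dp_mapE h b : (forall j, (b <= j)%N -> Hout j h = 0) ->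
  dp_map h = \sum_(j < b) tens (Hout j h : T) ('X^j : divided_power k).
Proof.
move=> hb; rewrite /dp_map (fsbigE (iota 0 b)) ?iota_uniq //.
  rewrite -(big_mkord xpredT (fun j => tens (Hout j h : T) ('X^j : divided_power k))).
  by rewrite /index_iota subn0; apply: eq_bigl => j; rewrite in_setT.
move=> j _; rewrite mem_iota add0n -leqNgt => /hb hj.
by rewrite [X in tens X _](hj : _ = 0) tens0l.
Qed.

Lemma dp_map_semilinear : semilinear (idfun : {rmorphism P -> P}) phi
  (dp_map : homology_gmod C -> TD).
Proof.
move=> a h l; have [[b hb] [c lc]] := (Hout_fin h, Hout_fin l).
have hb' j : (maxn b c <= j)%N -> Hout j h = 0 by rewrite geq_max => /andP[/hb].
have lc' j : (maxn b c <= j)%N -> Hout j l = 0 by rewrite geq_max => /andP[_ /lc].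
rewrite (dp_mapE hb') (dp_mapE lc') (dp_mapE (b := maxn b c)) => [|j bcj]; last first.
  by rewrite linearP hb' // lc' // scaler0 addr0.
rewrite scaler_sumr -big_split; apply: eq_bigr => j _.
transitivity (tens (phi a *: (Hout j h : T) + (Hout j l : T)) ('X^j : divided_power k)).
  2: by rewrite tensDl tensZl.
congr (tens _ _); rewrite [LHS]linearP.
by congr (_ + _); exact/esym/descent_scaleE.
Qed.

Lemma dp_map_Hinj i h : dp_map (Hinj i h) = tens (h : T) ('X^i : divided_power k).
Proof.
rewrite (dp_mapE (b := i.+1)) => [|j ij]; last first.
  by rewrite Hout_Hinj ltn_eqF.
rewrite (bigD1 ord_max) // [X in tens X _](Hout_Hinj i i h) eqxx.
rewrite big1 => [|j ji]; first exact: addr0.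
have ij : Hout j (Hinj i h) = 0 :> T.
  by rewrite Hout_Hinj eq_sym (negPf (ji : (j : nat) != i)).
exact: etrans (congr1 (fun y : T => tens y ('X^j : divided_power k)) ij) (tens0l T _).
Qed.

Fact dp_coef_bilin j : bilin (fun (h : T) (p : divided_power k) => (p : {poly k})`_j *: h).
Proof.
split=> [p a h l|h a p q]; first by rewrite scalerDr !scalerA mulrC.
by rewrite coefD coefZ scalerDl scalerA.
Qed.

Definition dp_coef j : {linear TD -> T} := tlift (dp_coef_bilin j).

Lemma dp_coefE i j h : dp_coef j (tens h ('X^i : divided_power k)) = if i == j then h else 0.
Proof.
rewrite [LHS]tliftE coefXn eq_sym; case: eqP => _; first exact: scale1r.
exact: scale0r.
Qed.

(** The components of a class can be read off from its image, which makes [dp_map] injective. *)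
Lemma dp_map_coef j h : dp_coef j (dp_map h) = (Hout j h : T).
Proof.
(* The bound is enlarged beyond j so that the term of index j occurs in the sum. *)
have [b hb] := Hout_fin h; have hb' i : (maxn b j.+1 <= i)%N -> Hout i h = 0.
  by rewrite geq_max => /andP[/hb].
have jb : (j < maxn b j.+1)%N by rewrite leq_max ltnSn orbT.
rewrite (dp_mapE hb') linear_sum; under eq_bigr => i _ do rewrite dp_coefE.
rewrite -big_mkcond (big_ord1_eq _ (fun i => Hout i h : T)).
by rewrite jb.
Qed.

Lemma dp_map_bij : bijective (dp_map : homology_gmod C -> TD).
Proof.
have dl := dp_map_semilinear.
have inj_dp : injective dp_map.
  move=> h l hl; apply/eqP; rewrite -subr_eq0; apply/eqP.
  have d0 : dp_map (h - l) = 0 by rewrite (semilinearB dl) hl subrr.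
  have [b hlE] := Hexpansion (h - l).
  rewrite (hlE b) // big1 // => j _.
  rewrite [X in Hinj j X](_ : _ = 0) ?linear0 //.
  by rewrite -[LHS]dp_map_coef d0 linear0.
have surj_dp t : exists h, dp_map h = t.
  have [s ->] := tens_sum t; elim: s => [|[h p] s [l lE]].
    by exists 0; rewrite (semilinear0 dl) big_nil.
  rewrite big_cons -lE /=.
  suff [l' l'E] : exists l', dp_map l' = tens h p.
    by exists (l' + l); rewrite (semilinearD dl) l'E.
  rewrite -[p]coefK poly_def.
  elim/big_ind: _ => [|q q' [l1 l1E] [l2 l2E]|i _].
  - by exists 0; rewrite (semilinear0 dl) tens0r.
  - by exists (l1 + l2); rewrite (semilinearD dl) l1E l2E tensDr.
  exists (Hinj i (p`_i *: h)); rewrite dp_map_Hinj.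
  by rewrite tensZr -tensZl.
exists (fun t => sval (cid (surj_dp t))) => [h|t]; last exact: svalP (cid (surj_dp t)).
by apply: inj_dp; exact: svalP (cid (surj_dp (dp_map h))).
Qed.

Lemma Hout_deg i j h : Hout j (hpr C i h) = hpr N (i - j.*2%:Z) (Hout j h).
Proof. by apply: hmap_deg => x; exact: out_deg. Qed.

Lemma tpr_Xn i j (h : T) : tpr T (divided_power k) i (tens h ('X^j : divided_power k)) =
  tens (gpr (i - j.*2%:Z) h) ('X^j : divided_power k).
Proof.
have Xj : gpr j.*2%:Z ('X^j : divided_power k) = 'X^j.
  by rewrite [LHS]dp_funE eqxx.
move: h; apply: homog_ind => [|h l hE lE|l h hl].
- by rewrite linear0 !tens0l linear0.
- by rewrite linearD !tensDl linearD hE lE.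
rewrite (tprE _ hl Xj) (gpr_homog _ hl) subr_eq.
by case: eqP => _; rewrite ?tens0l.
Qed.

Lemma divided_power_homology : piso (idfun : {rmorphism P -> P}) phi
  (homology_gmod C) (tensor_gmod T (divided_power k)).
Proof.
exists dp_map; split; [exact: dp_map_bij|exact: dp_map_semilinear|move=> i h].
have [b hb] := Hout_fin h.
rewrite (dp_mapE hb) (dp_mapE (b := b)) => [|j bj]; last first.
  by rewrite [LHS]Hout_deg hb // linear0.
rewrite linear_sum; apply: eq_bigr => j _; rewrite [RHS]tpr_Xn.
by congr (tens _ _); exact: Hout_deg.
Qed.
End DividedPowerHomology.

Lemma signz_double (R : pzRingType) (i : int) (j : nat) :
  (-1) ^+ absz (i + j.*2%:Z) = (-1) ^+ absz i :> R.
Proof.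
elim: j => [|j IHj]; first by rewrite addr0.
have -> : i + j.+1.*2%:Z = i + j.*2%:Z + 1 + 1 by lia.
by rewrite !signz_succ opprK.
Qed.

Section TrivialDividedPower.
Variables (P : comNzRingType) (L : lmodType P) (G : proj_resolution L) (M : complex P).
Local Notation X := (dpow0 G).

Lemma dpow0_dE m (a : G) : cd (dpin G m a : X) = dpin G m (cd a).
Proof.
rewrite [LHS]dpow_dE big_ord_recl subn0 big1 ?addr0 // => i _.
exact: linear0.
Qed.

Lemma dpin_homog j i (a : G) : gpr i a = a ->
  gpr (i + j.*2%:Z) (dpin G j a : X) = dpin G j a.
Proof. by move=> ai; rewrite [LHS]dpow_pr_dpin addrK ai. Qed.

Lemma gsignD (A : complex P) (a b : A) : gsign (a + b) = gsign a + gsign b.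
Proof. exact: (linearD (@gsign P A)). Qed.
Lemma gsign0 (A : complex P) : gsign (0 : A) = 0.
Proof. exact: (linear0 (@gsign P A)). Qed.

(** The y^(j) have even degree and do not affect signs. *)
Lemma gsign_dpin j (a : G) : gsign (dpin G j a : X) = dpin G j (gsign a).
Proof.
move: a; apply: homog_ind => [|a b aE bE|i a ai].
- by rewrite gsign0 linear0 gsign0.
- rewrite gsignD [RHS]linearD -aE -bE [dpin G j (a + b)]linearD; exact: gsignD.
rewrite (gsignE (dpin_homog j ai)) (gsignE ai) signz_double.
by rewrite linearZ_LR.
Qed.

Lemma gsign_dpout j (x : X) : gsign (dpout G j x) = dpout G j (gsign x).
Proof.
move: x; apply: dpow_ind => [|x y xE yE|l a].
- by rewrite linear0 gsign0 linear0.
- apply: etrans (congr1 (@gsign P G) (linearD (dpout G j) x y)) _.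
  apply: etrans (gsignD _ _) _; rewrite xE yE; apply: esym.
  exact: etrans (congr1 (dpout G j) (gsignD (A := X) x y)) (linearD _ _ _).
by rewrite gsign_dpin !dpinE; case: eqP => _ //; rewrite gsign0.
Qed.

Lemma cd_dpout j (x : X) : cd (dpout G j x) = dpout G j (cd x).
Proof.
move: x; apply: dpow_ind => [|x y xE yE|l a].
- by rewrite !linear0.
- apply: etrans (congr1 (@cd P G) (linearD (dpout G j) x y)) _.
  rewrite linearD xE yE; apply: esym.
  exact: etrans (congr1 (dpout G j) (linearD (@cd P X) x y)) (linearD _ _ _).
by rewrite dpow0_dE !dpinE; case: eqP => _ //; rewrite linear0.
Qed.

Lemma dpow_homology (k : comNzRingType) (phi : {rmorphism P -> k})
    (phi_surj : forall c, exists a, phi a = c)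
    (annN : annihilated phi (homology_gmod (tensor_complex G M))) :
  piso (idfun : {rmorphism P -> P}) phi (homology_gmod (tensor_complex X M))
    (tensor_gmod (descent_gmod phi_surj annN) (divided_power k)).
Proof.
apply: (@divided_power_homology P k phi phi_surj (tensor_complex G M)
  (tensor_complex X M) (fun j => tmap M (dpin G j : {linear G -> X}))
  (fun j => tmap M (dpout G j : {linear X -> G}))).
- move=> j x; apply: esym; apply: tmap_chain => a; first exact: gsign_dpin.
  exact: dpow0_dE.
- move=> j x; apply: esym; apply: tmap_chain => a; first exact: gsign_dpout.
  exact: cd_dpout.
- move=> i j; apply: tensor_ind => [|t t' tE t'E|i' j' x m _ _].
  + by rewrite !linear0 if_same.
  + by rewrite !linearD tE t'E; case: eqP => _; rewrite ?addr0.
  rewrite !tmapE dpinE; case: eqP => _ //; exact: tens0l.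
- move=> i j x; rewrite (tmap_deg (r := - j.*2%:Z)) // => l y yl.
  by rewrite -[in RHS]yl [RHS]dpout_pr.
apply: tensor_ind => [|t t' [b tE] [b' t'E]|i j x m _ _].
- by exists 0%N => c _; rewrite big1 // => j _; rewrite !linear0.
- exists (maxn b b') => c; rewrite geq_max => /andP[/tE{1}-> /t'E{1}->].
  by rewrite -big_split; apply: eq_bigr => j _; rewrite !linearD.
suff [b xE] : exists b, forall c, (b <= c)%N -> x = \sum_(j < c) dpin G j (dpout G j x).
  exists b => c /xE{1}->; elim/big_rec2: _ => [|l y y' _ <-]; first exact: tens0l.
  by rewrite !tmapE (@tensDl P X M).
move: x; apply: dpow_ind => [|x y [b xE] [b' yE]|l a].
- by exists 0%N => c _; rewrite big1 // => l _; rewrite !linear0.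
- exists (maxn b b') => c; rewrite geq_max => /andP[/xE{1}-> /yE{1}->].
  by rewrite -big_split; apply: eq_bigr => l _; rewrite !linearD.
exists l.+1 => c lc; rewrite (bigD1 (Ordinal lc)) // dpinE eqxx.
rewrite big1 => [|l' ll']; first exact/esym/addr0.
rewrite dpinE; case: eqP => ll; last exact: linear0.
by case/eqP: ll'; apply: val_inj.
Qed.
End TrivialDividedPower.

(** * Tor over hypersurfaces *)

Section Hypersurface.
Variables (P : comNzRingType) (n I : idealr P) (sIn : {subset I <= n}).
Variable M : complex {ideal_quot I}.

Lemma quot_proj_eq0 (J : idealr P) a : quot_proj J a = 0 <-> a \in J.
Proof.
split=> [a0|aJ].
  rewrite -[a]subr0 Quotient.idealrBE; apply/eqP.
  exact: etrans a0 (esym (rmorph0 (quot_proj J))).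
apply: etrans (rmorph0 (quot_proj J)); apply/eqP.
by rewrite -[_ == _]Quotient.idealrBE subr0.
Qed.

Lemma residue_killed a (y : residue n) : a \in n -> a *: y = 0.
Proof.
move=> /quot_proj_eq0 an; rewrite -[LHS]/(quot_proj n a *: (y : {ideal_quot n}^o)).
by rewrite an scale0r.
Qed.

Section Generator.
Variables (f : P) (If : f \in I).
Local Notation Pf := {ideal_quot (principal If)}.
Local Notation u := (quot_proj (principal If)).

Lemma quot_principal_ker a : u a = 0 -> exists b, a = b * f.
Proof. by move=> /quot_proj_eq0/asboolP. Qed.

Lemma quot_principal_gen : u f = 0.
Proof. by apply/quot_proj_eq0/asboolP; exists 1; rewrite mul1r. Qed.

Lemma quot_proj_factor (J : idealr P) (sfJ : {subset principal If <= J}) a :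
  quot_proj J a = quot_map sfJ (u a).
Proof. exact/esym/quot_mapE. Qed.

Lemma residue_quot_semilinear : semilinear (idfun : {rmorphism P -> P}) u
  (id : residue n -> residue_quot sIn If).
Proof.
move=> a x y; congr (_ + _).
rewrite -[LHS]/(quot_proj n a *: (x : {ideal_quot n}^o)).
by rewrite (quot_proj_factor (@principal_sub_max P n I sIn f If)).
Qed.

(** The supplied resolution [F] gives way to G<y>/f G<y>, and the k-structure of Tor to that over
    P/(f); both changes respect the action of P. *)
Lemma tor_quot_dpow (G : proj_resolution (residue n)) s
    (fs : homotopy_system (G := G) f s) (F : proj_resolution (residue_quot sIn If)) :
  GRing.lreg f ->
  piso (quot_proj n) u (tor_quot M F)
    (homology_gmod (tensor_complex
      (dpow_bar (@quot_proj_surj P (principal If)) quot_principal_ker fs)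
      (restr_complex (quot_map (principal_sub If)) M))).
Proof.
move=> regf; have id_bij : bijective (id : residue n -> residue_quot sIn If) by exists id.
pose X := dpow_resolution (@quot_proj_surj P (principal If)) quot_principal_ker
  quot_principal_gen residue_quot_semilinear id_bij regf fs.
apply: piso_trans (resolution_independence u F X _).
apply: piso_sym; apply: piso_descent.
exact: (quot_proj_factor (@principal_sub_max P n I sIn f If)).
Qed.
End Generator.

Lemma tor_quot_congruent (f g : P) (If : f \in I) (Ig : g \in I) :
  GRing.lreg f -> GRing.lreg g -> ideal_prod n I (f - g) ->
  forall (F : proj_resolution (residue_quot sIn If))
    (G : proj_resolution (residue_quot sIn Ig)),
  giso (tor_quot M F) (tor_quot M G).
Proof.
move=> regf regg fg F G; have [K] := free_resolution (residue n).
(* Here 0 + g * 1 = g, and g kills k because it lies in [n]. *)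
have [|t gt _] := system_extension (trivial_system K) (a := g) _ 1.
  by move=> y; apply: residue_killed; exact: sIn.
rewrite add0r mulr1 in gt.
(* As f = g + (f - g), this gives a system for f congruent to [t] modulo [I]. *)
have [|s fs st] := system_ideal_prod (f := g) _ gt fg.
  by move=> a an y; exact: residue_killed.
rewrite addrCA subrr addr0 in fs.
apply: (piso_giso (@quot_proj_surj P n)).
apply: piso_trans (tor_quot_dpow fs F regf) _.
apply: piso_trans (piso_sym (tor_quot_dpow gt G regg)).
apply: (piso_twist_eq (v := quot_proj I)) => *.
- exact: quot_principal_gen.
- exact: quot_principal_gen.
- exact: quot_proj_factor.
- exact: quot_proj_factor.
apply: (twist_congruent (I := I)) => [a|i x]; last exact: st.
by move=> /quot_proj_eq0.
Qed.

Lemma tor_quot_product (f : P) (If : f \in I) :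
  GRing.lreg f -> ideal_prod n I f ->
  forall (F : proj_resolution (residue_quot sIn If)) (G : proj_resolution (residue n)),
  giso (tor_quot M F) (tensor_gmod (tor_base M G) (divided_power {ideal_quot n})).
Proof.
move=> regf nIf F G.
(* The system is built on the supplied resolution [G], so the trivial system leads directly to
   [tor_base M G]. *)
have [|s fs st] := system_ideal_prod (f := 0) _ (trivial_system G) nIf.
  by move=> a an y; exact: residue_killed.
rewrite add0r in fs; apply: (piso_giso (@quot_proj_surj P n)).
apply: piso_trans (tor_quot_dpow fs F regf) _.
apply: piso_trans (dpow_homology (@quot_proj_surj P n) _).
apply: piso_sym; apply: (piso_twist_trivial (v := quot_proj I)) => *.
- exact: quot_principal_gen.
- exact: quot_proj_factor.
apply: (twist_congruent (I := I)) => [a|i x]; last exact: st.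
by move=> /quot_proj_eq0.
Qed.
End Hypersurface.

Theorem theorem2p1 (P : comNzRingType) (noethP : noetherian P)
    (n : idealr P) (max_n : maximal_ideal n)
    (I : idealr P) (sIn : {subset I <= n})
    (regI : exists2 r, r \in I & GRing.lreg r)
    (M : complex {ideal_quot I}) :
  (forall f, f \in I ->
     exists2 h, ideal_prod n I h & GRing.lreg (f + h)) /\
  (forall (f g : P) (If : f \in I) (Ig : g \in I),
     GRing.lreg f -> GRing.lreg g -> ideal_prod n I (f - g) ->
     forall (F : proj_resolution (residue_quot sIn If))
            (G : proj_resolution (residue_quot sIn Ig)),
       giso (tor_quot M F) (tor_quot M G)) /\
  (forall (f : P) (If : f \in I),
     GRing.lreg f -> ideal_prod n I f ->
     forall (F : proj_resolution (residue_quot sIn If))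
            (G : proj_resolution (residue n)),
       giso (tor_quot M F)
            (tensor_gmod (tor_base M G) (divided_power {ideal_quot n}))).
Proof.
split; first by move=> f _; exact: (regular_coset noethP sIn regI).
split=> [f g If Ig regf regg fg F G|f If regf nIf F G].
  exact: tor_quot_congruent regf regg fg F G.
exact: tor_quot_product regf nIf F G.
Qed.
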